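(* Let $p$ be an odd prime and let $\Pi$ be the depth zero supercuspidal representation of $GL_2(\mathbb{Q}_p)$ with central character $\omega$ associated to a character $\nu:\mathbb{F}_{p^2}^*\to\mathbb{C}^*$, $\nu\neq\nu^p$. Let $\nu=\nu(a,b)$ and assume that $a+b$ is odd and $a>b$. Let $K/\mathbb{Q}_p$ be the unramified quadratic extension and let $\chi$ be a character of $K^*$, trivial on $1+p\mathcal{O}_K$, which agrees with $\omega$ on $\mathbb{Q}_p^*$ and which, viewed as a character of $\mathbb{F}_{p^2}^*$, is distinct from $\nu$ and $\nu^p$. Define characters of $\mathbb{F}_p^*$ by $\mu_1(x)=x^{(a+b-1)/2}$ and $\mu_2(x)=x^{(a+b+p)/2}$. If $a-b>1$, then: 1. $v_{\mu_1}$ is a test vector for $\chi$ if $\chi$ has Type 1. 2. $v_{\mu_2}$ is a test vector for $\chi$ if $\chi$ has Type 2. If $a-b=1$, then $v_{\mu_2}$ is a test vector for all such $\chi$.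
   Context: Representations. For a character $\nu:\mathbb{F}_{p^2}^*\to\mathbb{C}^*$ with $\nu\ne\nu^p$, $\rho(\nu)$ is the irreducible cuspidal complex representation of $GL_2(\mathbb{F}_p)$ of dimension $p-1$ attached to $\nu$ (central character $\nu|_{\mathbb{F}_p^*}$; trace $-(\nu(z)+\nu(z)^p)$ at an element with eigenvalues $z,z^p$, $z\in\mathbb{F}_{p^2}\setminus\mathbb{F}_p$); $\rho(\nu)\cong\rho(\nu^p)$. Given a character $\omega$ of $\mathbb{Q}_p^*$ whose restriction to $\mathbb{Z}_p^*$ is the inflation of $\nu|_{\mathbb{F}_p^*}$, the depth zero supercuspidal representation $\Pi$ associated to $\nu$ (and $\omega$) is the irreducible smooth admissible supercuspidal representation of $GL_2(\mathbb{Q}_p)$ with central character $\omega$ whose type $V(\Pi)$, i.e. its space of vectors fixed by the matrices in $GL_2(\mathbb{Z}_p)$ congruent to $1$ modulo $p$, is as a representation of $GL_2(\mathbb{Z}_p)$ the inflation of $\rho(\nu)$. Torus and test vectors. Fix a non-square unit $\xi\in\mathbb{Z}_p^*$. $T=K^*$ is embedded in $GL_2(\mathbb{Q}_p)$ as the matrices $\begin{pmatrix} x&y\\ y\xi&x\end{pmatrix}$; reduction mod $p$ embeds $\mathbb{F}_{p^2}^*$ in $GL_2(\mathbb{F}_p)$. Characters of $K^*$ trivial on $1+p\mathcal{O}_K$ and agreeing with $\omega$ on $\mathbb{Q}_p^*$ are identified with characters of $\mathbb{F}_{p^2}^*\cong\mathcal{O}_K^*/(1+p\mathcal{O}_K)$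 agreeing with $\nu$ on $\mathbb{F}_p^*$ (the value at $p$ being $\omega(p)$). A vector $v\in V(\Pi)$ is a test vector for $\chi$ if its projection to the $\chi$-eigenspace of $T$ in $\Pi$ is nonzero (equivalently, a nonzero $T$-equivariant functional $\ell_\chi:\Pi\to\chi$ exists and $\ell_\chi(v)\neq0$). For a character $\mu$ of $\mathbb{F}_p^*$, $v_\mu\in V(\Pi)$ is a nonzero vector, unique up to scalar, on which $\begin{pmatrix} x&0\\0&1\end{pmatrix}$, $x\in\mathbb{F}_p^*$, acts by $\mu(x)$ via $\rho(\nu)$. Labelling. Fix a prime of $\overline{\mathbb{Q}}$ above $p$, so that the complex $(p^2-1)$-th roots of unity are identified with $\mathbb{F}_{p^2}^*$; formulas such as $\mu_1(x)=x^{(a+b-1)/2}$ use this identification. Every character $\chi$ of $\mathbb{F}_{p^2}^*$ is $x\mapsto x^{r+ps}$ with $0\le r,s\le p-1$, unique once $(p-1,p-1)$ is excluded in favour of $(0,0)$; write $\chi=\chi(r,s)$ and $k_\chi=r+ps$. After possibly interchanging $\nu$ and $\nu^p$, $\nu=\nu(a,b)$ with $a>b$, and $k_\nu=a+pb<k_{\nu^p}=b+pa$. The character $\chi$ is of Type 1 if $k_\nu<k_\chi<k_{\nu^p}$, and of Type 2 otherwise. *)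

(* Defs.v *)
From HB Require Import structures.
From mathcomp Require Import all_boot all_order all_algebra.
From mathcomp Require Import all_fingroup all_field mxrepresentation.
From mathcomp Require Import boolp reals complex.

Set Implicit Arguments.
Unset Strict Implicit.
Unset Printing Implicit Defensive.

Import Order.TTheory GRing.Theory Num.Theory.
Local Open Scope ring_scope.
Local Open Scope complex_scope.

(* The p-adic integers, as the inverse limit of the rings Z/p^(n+1).  The     *)
(* record is indexed by the primality proof because the ring instances below  *)
(* need it.                                                                   *)
Record padic_int (p : nat) (p_pr : prime p) := PadicInt {
  trunc : forall n, 'Z_(p ^ n.+1);
  trunc_compat : forall n, (trunc n.+1 : nat)%:R = trunc n }.

Section PadicRing.
Variables (p : nat) (p_pr : prime p).
Local Notation Zp := (padic_int p_pr).

Lemma ppow_gt1 n : (1 < p ^ n.+1)%N.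
Proof. by rewrite -(exp1n n.+1) ltn_exp2r // prime_gt1. Qed.

Lemma padic_ext (x y : Zp) : (forall n, trunc x n = trunc y n) -> x = y.
Proof.
case: x y => [x xP] [y yP] /= exy.
have {}exy : x = y by apply: functional_extensionality_dep.
by rewrite {}exy in xP *; congr PadicInt; apply: Prop_irrelevance.
Qed.

Lemma trunc_modn (x : Zp) n m : (n <= m)%N ->
  trunc x n = (trunc x m %% p ^ n.+1)%N :> nat.
Proof.
elim: m => [|m IHm]; first by rewrite leqn0 => /eqP->; rewrite modn_small ?ltn_ord //
  -[X in (_ < X)%N](Zp_cast (ppow_gt1 0)).
rewrite leq_eqVlt => /orP[/eqP->|le_n_m].
  by rewrite modn_small // -[X in (_ < X)%N](Zp_cast (ppow_gt1 m.+1)).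
rewrite (IHm le_n_m) -(trunc_compat x m) val_Zp_nat ?ppow_gt1 //.
by rewrite modn_dvdm // dvdn_exp2l.
Qed.

Fact Zp_valD n (a b : 'Z_(p ^ n.+1)) :
  nat_of_ord (a + b)%R = ((a + b) %% p ^ n.+1)%N.
Proof. by rewrite /=; congr (_ %% _)%N; apply: Zp_cast (ppow_gt1 n). Qed.

Fact Zp_valM n (a b : 'Z_(p ^ n.+1)) :
  nat_of_ord (a * b)%R = ((a * b) %% p ^ n.+1)%N.
Proof. by rewrite /=; congr (_ %% _)%N; apply: Zp_cast (ppow_gt1 n). Qed.

Fact Zp_castD n (a b : 'Z_(p ^ n.+2)) :
  (nat_of_ord (a + b)%R)%:R = (a : nat)%:R + (b : nat)%:R :> 'Z_(p ^ n.+1).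
Proof.
rewrite -natrD; apply: ord_inj; rewrite !val_Zp_nat ?ppow_gt1 //.
by rewrite Zp_valD modn_dvdm // dvdn_exp2l.
Qed.

Fact Zp_castM n (a b : 'Z_(p ^ n.+2)) :
  (nat_of_ord (a * b)%R)%:R = (a : nat)%:R * (b : nat)%:R :> 'Z_(p ^ n.+1).
Proof.
rewrite -natrM; apply: ord_inj; rewrite !val_Zp_nat ?ppow_gt1 //.
by rewrite Zp_valM modn_dvdm // dvdn_exp2l.
Qed.

Fact Zp_castN n (a : 'Z_(p ^ n.+2)) :
  (nat_of_ord (- a)%R)%:R = - (a : nat)%:R :> 'Z_(p ^ n.+1).
Proof. by apply/eqP; rewrite -addr_eq0 -Zp_castD addNr. Qed.

Fact Zp_cast1 n : (nat_of_ord (1 : 'Z_(p ^ n.+2))%R)%:R = 1 :> 'Z_(p ^ n.+1).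
Proof. by []. Qed.

Definition padic_zero : Zp := @PadicInt p p_pr (fun=> 0) (fun=> erefl).
Definition padic_one : Zp := @PadicInt p p_pr (fun=> 1) Zp_cast1.
Fact padic_add_subproof (x y : Zp) n :
  (nat_of_ord (trunc x n.+1 + trunc y n.+1)%R)%:R = trunc x n + trunc y n.
Proof. by rewrite Zp_castD !trunc_compat. Qed.
Definition padic_add (x y : Zp) : Zp := PadicInt p_pr (padic_add_subproof x y).
Fact padic_mul_subproof (x y : Zp) n :
  (nat_of_ord (trunc x n.+1 * trunc y n.+1)%R)%:R = trunc x n * trunc y n.
Proof. by rewrite Zp_castM !trunc_compat. Qed.
Definition padic_mul (x y : Zp) : Zp := PadicInt p_pr (padic_mul_subproof x y).
Fact padic_opp_subproof (x : Zp) n :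
  (nat_of_ord (- trunc x n.+1)%R)%:R = - trunc x n.
Proof. by rewrite Zp_castN trunc_compat. Qed.
Definition padic_opp (x : Zp) : Zp := PadicInt p_pr (padic_opp_subproof x).

HB.instance Definition _ := gen_eqMixin Zp.
HB.instance Definition _ := gen_choiceMixin Zp.

Fact padic_addA : associative padic_add.
Proof. by move=> x y z; apply: padic_ext => n /=; rewrite addrA. Qed.
Fact padic_addC : commutative padic_add.
Proof. by move=> x y; apply: padic_ext => n /=; rewrite addrC. Qed.
Fact padic_add0 : left_id padic_zero padic_add.
Proof. by move=> x; apply: padic_ext => n /=; rewrite add0r. Qed.
Fact padic_addN : left_inverse padic_zero padic_opp padic_add.
Proof. by move=> x; apply: padic_ext => n /=; rewrite addNr. Qed.
HB.instance Definition _ := GRing.isZmodule.Build Zp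
  padic_addA padic_addC padic_add0 padic_addN.

Fact padic_mulA : associative padic_mul.
Proof. by move=> x y z; apply: padic_ext => n /=; rewrite mulrA. Qed.
Fact padic_mulC : commutative padic_mul.
Proof. by move=> x y; apply: padic_ext => n /=; rewrite mulrC. Qed.
Fact padic_mul1 : left_id padic_one padic_mul.
Proof. by move=> x; apply: padic_ext => n /=; rewrite mul1r. Qed.
Fact padic_mulD : left_distributive padic_mul padic_add.
Proof. by move=> x y z; apply: padic_ext => n /=; rewrite mulrDl. Qed.
Fact padic_one_neq0 : padic_one != 0.
Proof. by apply/eqP => /(congr1 (fun x : Zp => trunc x 0)) /eqP. Qed.
HB.instance Definition _ :=
  GRing.Zmodule_isComNzRing.Build Zp
    padic_mulA padic_mulC padic_mul1 padic_mulD padic_one_neq0.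

Definition padic_unit (x : Zp) : bool := `[< exists y, y * x = 1 >].
Definition padic_inv (x : Zp) : Zp :=
  if pselect (exists y, y * x = 1) is left e then projT1 (cid e) else x.
Fact padic_mulV : {in padic_unit, left_inverse 1 padic_inv *%R}.
Proof. by move=> x /asboolP ux; rewrite /padic_inv; case: pselect => // e; case: cid. Qed.
Fact padic_unitPl (x y : Zp) : y * x = 1 -> padic_unit x.
Proof. by move=> e; apply/asboolP; exists y. Qed.
Fact padic_inv_out : {in [predC padic_unit], padic_inv =1 id}.
Proof.
by move=> x /negP ux; rewrite /padic_inv; case: pselect => // e; case: ux; apply/asboolP.
Qed.
HB.instance Definition _ :=
  GRing.ComNzRing_hasMulInverse.Build Zp padic_mulV padic_unitPl padic_inv_out.

Fact trunc_neq0 (x : Zp) : x != 0 -> exists n, forall m, (n <= m)%N ->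
  (0 < trunc x m)%N /\ (logn p (trunc x m) <= n)%N.
Proof.
move=> x0; have [n xn0] : exists n, trunc x n != 0.
  apply: contrapT => noNZ; case/eqP: x0; apply: padic_ext => n.
  by apply/eqP/negPn/negP => xn0; apply: noNZ; exists n.
exists n => m le_nm; have := trunc_modn x le_nm.
have {}xn0 : trunc x n != 0%N :> nat by [].
move=> exn; have ndvd : ~~ (p ^ n.+1 %| trunc x m)%N by rewrite /dvdn -exn.
have xm0 : (0 < trunc x m)%N.
  by rewrite lt0n; apply: contraNneq ndvd => ->; rewrite dvdn0.
by split=> //; rewrite leqNgt; apply: contra ndvd => ?; rewrite pfactor_dvdn.
Qed.

Fact padic_mulf_eq0 : GRing.integral_domain_axiom Zp.
Proof.
move=> x y xy0; apply/norP => -[/trunc_neq0[n xP] /trunc_neq0[m yP]].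
have [x0 lx] := xP _ (leq_addr m n); have [y0 ly] := yP _ (leq_addl n m).
have := congr1 (fun z : Zp => nat_of_ord (trunc z (n + m)%N)) xy0.
rewrite [LHS]Zp_valM => /eqP; rewrite -/(dvdn _ _) pfactor_dvdn ?muln_gt0 ?x0 //.
by rewrite lognM // ltnNge leq_add.
Qed.
HB.instance Definition _ := GRing.ComUnitRing_isIntegral.Build Zp padic_mulf_eq0.

Lemma truncD (x y : Zp) n : trunc (x + y) n = trunc x n + trunc y n.
Proof. by []. Qed.

Lemma truncM (x y : Zp) n : trunc (x * y) n = trunc x n * trunc y n.
Proof. by []. Qed.

End PadicRing.

Notation padic p_pr := {fraction padic_int p_pr}.

Definition residue (p : nat) (p_pr : prime p) (z : padic_int p_pr) : 'F_p :=
  (nat_of_ord (trunc z 0))%:R.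

Definition mx2 (T : Type) (a b c d : T) : 'M[T]_2 :=
  \matrix_(i, j) if i == 0 then (if j == 0 then a else b)
                 else (if j == 0 then c else d).

Definition torus_mx (A : pzRingType) (xi x y : A) : 'M[A]_2 :=
  mx2 x y (y * xi) x.

(* Characters F^* -> C^* are represented by functions on F, whose value at 0  *)
(* is irrelevant.                                                             *)
Definition is_character (F : fieldType) (C : fieldType) (chi : F -> C) : Prop :=
  (forall x, x != 0 -> chi x != 0) /\
  (forall x y, x != 0 -> y != 0 -> chi (x * y) = chi x * chi y).

Definition sqrt_extension (F : fieldType) (L : fieldExtType F) (c : F) (d : L)
    : Prop :=
  \dim {:L} = 2%N /\ d ^+ 2 = c%:A.

(* A prime of the algebraic closure of Q in C above p: a prime ideal of the   *)
(* ring of all algebraic integers of C that contains p.                       *)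
Definition algebraic_integer (C : fieldType) (x : C) : Prop :=
  integralOver (intr : int -> C) x.

Record prime_ideal_above (C : fieldType) (p : nat) (P : C -> Prop) : Prop := {
  prime_above_int : forall x, P x -> algebraic_integer x;
  prime_above_p : P p%:R;
  prime_above_1 : ~ P 1;
  prime_aboveD : forall x y, P x -> P y -> P (x + y);
  prime_aboveM : forall x y, algebraic_integer x -> P y -> P (x * y);
  prime_above_prime : forall x y, algebraic_integer x -> algebraic_integer y ->
    P (x * y) -> P x \/ P y }.

(* The identification of k^* with the roots of unity of order |k| - 1 in C    *)
(* determined by P: composed with reduction modulo P, tau is a ring           *)
(* homomorphism, i.e. an embedding of k in the residue field of P.            *)
Definition teichmuller (C : fieldType) (P : C -> Prop) (k : fieldType)
    (tau : k -> C) : Prop :=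
  [/\ tau 0 = 0, is_character tau
    & forall x y, P (tau (x + y) - (tau x + tau y))].

(* The cuspidal representation rho(nu) of GL_2(F_p); an elliptic element is   *)
(* recognized by its characteristic polynomial over k = F_(p^2).              *)
Definition cuspidal_rep (C : fieldType) (p : nat) (k : fieldExtType 'F_p)
    (nu : k -> C) (rho : mx_representation C 'GL_2(p) p.-1) : Prop :=
  [/\ mx_irreducible rho,
      forall w : 'cV[C]_p.-1,
        (forall (g : {'GL_2(p)}) (u : 'F_p),
           GLval g = mx2 1 u 0 1 -> rho g *m w = w) -> w = 0,
      forall (g : {'GL_2(p)}) (x : 'F_p),
        x != 0 -> GLval g = x%:M -> rho g = (nu x%:A)%:M
    & forall (g : {'GL_2(p)}) (z : k), z \notin 1%VS ->
        map_poly (in_alg k) (char_poly (GLval g))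
          = ('X - z%:P) * ('X - (z ^+ p)%:P) ->
        \tr (rho g) = - (nu z + nu z ^+ p)].

Section PadicRepresentation.
Variables (p : nat) (p_pr : prime p) (C : fieldType) (V : lmodType C).
Local Notation Zp := (padic_int p_pr).
Local Notation Qp := (padic p_pr).
(* The values of pi outside GL_2(Q_p) are irrelevant. *)
Variable pi : 'M[Qp]_2 -> V -> V.

Definition GL2_representation : Prop :=
  [/\ forall g, g \in unitmx -> linear (pi g),
      forall v, pi 1%:M v = v
    & forall g h v, g \in unitmx -> h \in unitmx ->
        pi (g *m h) v = pi g (pi h v)].

Definition subrepresentation (U : V -> Prop) : Prop :=
  [/\ U 0, forall c u v, U u -> U v -> U (c *: u + v)
    & forall g v, g \in unitmx -> U v -> U (pi g v)].

Definition irreducible_rep : Prop :=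
  (exists v : V, v != 0) /\
  forall U, subrepresentation U -> (forall v, U v -> v = 0) \/ (forall v, U v).

(* 1 + p^(n+1) M_2(Z_p); these subgroups form a basis of neighbourhoods of 1. *)
Definition congruence_subgroup (n : nat) (g : 'M[Qp]_2) : Prop :=
  exists B : 'M[Zp]_2,
    g = map_mx (@FracField.tofrac Zp) (1%:M + p%:R ^+ n.+1 *: B).

Definition fixed_vector (n : nat) (v : V) : Prop :=
  forall g, congruence_subgroup n g -> pi g v = v.

Definition smooth_rep : Prop := forall v, exists n, fixed_vector n v.

Definition admissible_rep : Prop :=
  forall n, exists (m : nat) (e : 'I_m -> V),
    forall v, fixed_vector n v -> exists c : 'I_m -> C, v = \sum_i c i *: e i.

(* The Jacquet module V / V(N) vanishes. *)
Definition supercuspidal_rep : Prop :=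
  forall v, exists (m : nat) (u : 'I_m -> Qp) (w : 'I_m -> V),
    v = \sum_i (pi (mx2 1 (u i) 0 1) (w i) - w i).

Definition has_central_character (omega : Qp -> C) : Prop :=
  forall x v, x != 0 -> pi x%:M v = omega x *: v.

(* The space of vectors fixed by 1 + p M_2(Z_p) is, as a representation of    *)
(* GL_2(Z_p), isomorphic via f to the inflation of rho.                       *)
Definition has_type (n : nat) (rho : mx_representation C 'GL_2(p) n) : Prop :=
  exists f : 'cV[C]_n -> V,
    [/\ linear f, injective f,
        forall v, fixed_vector 0 v <-> exists w, f w = v
      & forall (A : 'M[Zp]_2) (g : {'GL_2(p)}) w,
          GLval g = map_mx (@residue p p_pr) A ->
          pi (map_mx (@FracField.tofrac Zp) A) (f w) = f (rho g *m w)].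

Definition depth_zero_supercuspidal (k : fieldExtType 'F_p) (nu : k -> C)
    (omega : Qp -> C) : Prop :=
  [/\ GL2_representation, irreducible_rep, smooth_rep, admissible_rep
    & supercuspidal_rep] /\
  [/\ has_central_character omega,
      forall z : Zp, z \is a GRing.unit ->
        omega (@FracField.tofrac Zp z) = nu (residue z)%:A
    & exists rho, cuspidal_rep nu rho /\ has_type rho].

Definition torus_eigenvector (mu : 'F_p -> C) (v : V) : Prop :=
  [/\ fixed_vector 0 v, v != 0
    & forall x : Zp, x \is a GRing.unit ->
        pi (mx2 (@FracField.tofrac Zp x) 0 0 1) v = mu (residue x) *: v].

Section Torus.
Variables (xi : Zp) (K : fieldExtType Qp) (delta : K).

Definition torus_eigenspace (eta : K -> C) (w : V) : Prop :=
  forall x y : Qp, x%:A + y *: delta != 0 ->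
    pi (torus_mx (@FracField.tofrac Zp xi) x y) w
      = eta (x%:A + y *: delta) *: w.

(* w is the component of v in the chi-eigenspace of K^*, relative to the      *)
(* decomposition of V as the direct sum of the eigenspaces of K^*.            *)
Definition eigenprojection (chi : K -> C) (v w : V) : Prop :=
  torus_eigenspace chi w /\
  exists (m : nat) (eta : 'I_m -> K -> C) (u : 'I_m -> V),
    (forall i, [/\ is_character (eta i), exists2 z, z != 0 & eta i z != chi z
      & torus_eigenspace (eta i) (u i)]) /\ v = w + \sum_i u i.

Definition test_vector (chi : K -> C) (v : V) : Prop :=
  exists2 w, eigenprojection chi v w & w != 0.

End Torus.
End PadicRepresentation.

Section TorusCharacters.
Variables (p : nat) (p_pr : prime p) (C : fieldType).
Local Notation Zp := (padic_int p_pr).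
Local Notation Qp := (padic p_pr).
Variables (K : fieldExtType Qp) (delta : K) (k : fieldExtType 'F_p) (d : k).

Definition OK_elt (x y : Zp) : K :=
  (@FracField.tofrac Zp x)%:A + @FracField.tofrac Zp y *: delta.

Definition OK_red (x y : Zp) : k := (residue x)%:A + residue y *: d.

Definition trivial_on_1pOK (chi : K -> C) : Prop :=
  forall x y : Zp, chi (1 + p%:R * OK_elt x y) = 1.

(* The restriction of chi to O_K^* is the inflation of chibar: the units of   *)
(* O_K are the elements with nonzero reduction.                               *)
Definition inflates (chibar : k -> C) (chi : K -> C) : Prop :=
  forall x y : Zp, OK_red x y != 0 -> chi (OK_elt x y) = chibar (OK_red x y).

Variable tau : k -> C.

(* chi(r,s), with the labels normalized so as to be unique. *)
Definition label_char (r s : nat) (z : k) : C := tau z ^+ (r + p * s).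

Definition is_label (r s : nat) : Prop :=
  [/\ (r < p)%N, (s < p)%N & (r, s) != (p.-1, p.-1)].

(* a, b are the labels of nu, so that k_nu = a + p b and k_(nu^p) = b + p a. *)
Definition type1 (a b : nat) (chi : K -> C) : Prop :=
  exists r s, [/\ is_label r s, inflates (label_char r s) chi
    & (a + p * b < r + p * s < b + p * a)%N].

Definition type2 (a b : nat) (chi : K -> C) : Prop := ~ type1 a b chi.

End TorusCharacters.

(* Main.v *)
Require Import Defs.
From HB Require Import structures.
From mathcomp Require Import all_boot all_order all_algebra.
From mathcomp Require Import all_fingroup all_solvable all_field.
From mathcomp Require Import mxrepresentation generic_quotient boolp.
From mathcomp Require Import reals complex.
From mathcomp Require Import ring zify.

Set Implicit Arguments.
Unset Strict Implicit.
Unset Printing Implicit Defensive.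

Import GRing.Theory.
Local Open Scope ring_scope.
Local Open Scope complex_scope.

(** The vector [v] lies in the type of [pi], which is the inflation of the
    cuspidal representation [rho] of GL_2(F_p), and K^x acts on the type through
    p^Z and the nonsplit torus F_(p^2)^x.  The component of [v] in the
    chi-eigenspace is therefore [E v], where [E] is the projector of [rho] on
    the chi-eigenspace of the nonsplit torus: the question is one about the
    finite group.  Let [M] be the projector of [rho] on the mu-eigenspace of the
    split torus of matrices diag(x, 1).  Every character of this torus has
    multiplicity one in [rho], so [M] has rank one and image spanned by [v]
    ([split_proj_rank1]), and [E v = 0] would imply [tr (E M) = 0].

    Up to a nonzero rational factor, [tr (E M)] is the sum of
    chi(z)^-1 mu(x)^-1 tr rho(z diag(x, 1)) over z and x, an algebraic integer,
    and it is enough to see that it is nonzero modulo the prime [P] above p.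
    Modulo [P] the character of [rho] becomes that of the direct sum of
    Sym^(a-b-2) (x) det^(b+1) and Sym^(p-1-(a-b)) (x) det^a, where the first
    summand is absent if a - b = 1 ([trace_reduces]).  The nonsplit torus acts on
    the first summand by the characters of Type 1, each with multiplicity one,
    and on the second one by the remaining characters, [nu] and [nu^p] excepted.
    So only one summand contributes to the sum for a given chi, and mu_1, resp.
    mu_2, is a weight nearest to the middle of the first, resp. second, summand.

    In Sym^n the eigenvectors are X^i Y^(n-i) for the split torus and
    (X + dY)^j (X - dY)^(n-j) for the nonsplit one.  The trace of the product of
    the two projectors is hence, up to a power of 2, the product of the
    coefficient of t^i in (t+1)^j (t-1)^(n-j) and of that of t^j in
    (t+1)^i (t-1)^(n-i).  These Krawtchouk coefficients agree up to binomial
    coefficients which are prime to p ([kraw_reciprocity]).  As a + b is odd, n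
    is odd and i = (n-1)/2 or (n+1)/2, so the second one is a coefficient of
    (t^2-1)^m (t-1) or (t^2-1)^m (t+1) with m < p, that is a binomial coefficient
    up to sign, which is nonzero modulo p ([kraw_near_middle]).  This gives
    [torus_brauer_sum_neq0] in characteristic p and [torus_proj_neq0] for [rho].

    Over the p-adic numbers one has to know that the residue of [xi] is not a
    square ([hensel_sqrt]), so that F_(p^2) is the residue field of K and K^x is
    generated by Q_p^x and the units ([OK_repr]), that chi is the inflation of
    one of the p + 1 characters of F_(p^2)^x that agree with [nu] on F_p^x
    ([char_label]), and that all these characters extend to K^x
    ([angular_char]), so that the other components of [v] are eigenvectors
    too. *)

(** * Lucas sequences and traces of symmetric powers *)

Section Lucas.
Variable R : comNzRingType.

(** If t and delta are the trace and the determinant of a two-by-two matrix g,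
    this is the trace of g on Sym^(n-1), the complete homogeneous symmetric
    polynomial of degree n - 1 in the eigenvalues. *)
Fixpoint lucas (t delta : R) (n : nat) : R :=
  match n with
  | 0 => 0
  | n1.+1 => if n1 is n2.+1 then t * lucas t delta n1 - delta * lucas t delta n2
             else 1
  end.

Lemma lucasSS t delta n :
  lucas t delta n.+2 = t * lucas t delta n.+1 - delta * lucas t delta n.
Proof. by []. Qed.

Lemma nat_pair_ind (Q : nat -> Prop) :
  Q 0%N -> Q 1%N -> (forall n, Q n -> Q n.+1 -> Q n.+2) -> forall n, Q n.
Proof.
move=> Q0 Q1 QS n; suff [] : Q n /\ Q n.+1 by [].
by elim: n => [|n [IH0 IH1]]; split=> //; apply: QS.
Qed.

Lemma lucas_distinct x y n :
  (x - y) * lucas (x + y) (x * y) n = x ^+ n - y ^+ n.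
Proof.
elim/nat_pair_ind: n => [||n IH0 IH1]; first by rewrite mulr0 !expr0 subrr.
  by rewrite /= mulr1 !expr1.
rewrite lucasSS mulrBr mulrCA IH1 (mulrCA (x - y)) IH0 !exprS; ring.
Qed.

Lemma lucas_double x n : lucas (x + x) (x * x) n.+1 = x ^+ n *+ n.+1.
Proof.
elim/nat_pair_ind: n => [||n IH0 IH1]; first by rewrite /= expr0 mulr1n.
  by rewrite lucasSS /= mulr0 subr0 mulr1 expr1 mulr2n.
rewrite lucasSS IH0 IH1 -[n.+3]addn3 -[n.+2]addn2 -[n.+1]addn1 !mulrnDr !exprD.
ring.
Qed.

(** The right-hand side is the trace on the monomials X^j Y^(n-1-j) of the
    substitution X -> a X + b Y, Y -> c X + e Y, with Y set to 1.  Together with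
    the sum of the neighbouring coefficients of index j + 1 it satisfies a linear
    recurrence, obtained by splitting off one factor. *)
Lemma lucas_sym_trace (a b c e : R) n :
  lucas (a + e) (a * e - b * c) n =
    \sum_(j < n) ((a *: 'X + b%:P) ^+ j * (c *: 'X + e%:P) ^+ (n.-1 - j))`_j.
Proof.
set A := a *: 'X + b%:P; set B := c *: 'X + e%:P.
have coefA (F : {poly R}) j : (A * F)`_j.+1 = a * F`_j + b * F`_j.+1.
  by rewrite /A mulrDl -scalerAl coefD coefZ coefXM coefCM.
have coefB (F : {poly R}) j : (B * F)`_j.+1 = c * F`_j + e * F`_j.+1.
  by rewrite /B mulrDl -scalerAl coefD coefZ coefXM coefCM.
have coefB0 (F : {poly R}) : (B * F)`_0 = e * F`_0.
  by rewrite /B mulrDl -scalerAl coefD coefZ coefXM coefCM mulr0 add0r.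
have sizeA j : (size (A ^+ j) <= j.+1)%N.
  elim: j => [|j IHj]; first by rewrite expr0 size_poly1.
  rewrite exprS; apply/leq_sizeP => -[//|i] lt_ji.
  by rewrite coefA !nth_default ?mulr0 ?addr0 // (leq_trans IHj) // ltnW.
pose T n := \sum_(j < n) (A ^+ j * B ^+ (n.-1 - j))`_j.
pose U n := \sum_(j < n) (A ^+ j * B ^+ (n.-1 - j))`_j.+1.
have B0 m : (B ^+ m)`_0 = e ^+ m.
  by elim: m => [|m IHm]; rewrite ?expr0 ?coef1 // !exprS coefB0 IHm.
have TE m : T m.+1 = e ^+ m + (a * T m + b * U m).
  rewrite /T /U big_ord_recl /= subn0 expr0 mul1r B0 !mulr_sumr -big_split.
  congr (_ + _); apply: eq_bigr => j _ /=.
  by rewrite exprS -mulrA coefA (_ : m - bump 0 j = m.-1 - j)%N // /bump; lia.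
have UE m : U m.+1 = c * T m + e * U m.
  rewrite /T /U big_ord_recr /= subnn expr0 mulr1 (nth_default _ (sizeA m)) addr0.
  rewrite !mulr_sumr -big_split; apply: eq_bigr => j _ /=.
  have -> : (m - j)%N = (m.-1 - j).+1 by have := ltn_ord j; lia.
  by rewrite exprS mulrCA coefB.
(* Eliminating [U] between [TE] and [UE] gives the recurrence of [lucas]. *)
change (lucas (a + e) (a * e - b * c) n = T n).
elim/nat_pair_ind: n => [||m IH0 IH1]; first by rewrite /T big_ord0.
  by rewrite TE /T /U !big_ord0 !mulr0 !addr0 expr0.
rewrite lucasSS IH0 IH1 [T m.+2]TE UE exprS.
rewrite TE; ring.
Qed.

End Lucas.

(** * Krawtchouk coefficients *)

Section Krawtchouk.
Variable F : fieldType.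

Definition kraw (j i l : nat) : F := ((('X + 1) ^+ j * ('X - 1) ^+ i)`_l).

(** Homogenization: the coefficients of (t+1)^j (t-1)^i also expand
    (x+y)^j (x-y)^i. *)
Lemma kraw_homog (A : comAlgType F) (x y : A) j i :
  (x + y) ^+ j * (x - y) ^+ i =
    \sum_(l < (j + i).+1) kraw j i l *: (x ^+ l * y ^+ (j + i - l)).
Proof.
pose hom N (P : {poly F}) := \sum_(l < N.+1) P`_l *: (x ^+ l * y ^+ (N - l)).
have homS N (P : {poly F}) c : (size P <= N.+1)%N ->
    hom N.+1 (('X + c%:P) * P) = (x + c *: y) * hom N P.
  move=> sP; rewrite /hom !mulrDl; under eq_bigr do rewrite coefD scalerDl.
  rewrite big_split big_ord_recl /= coefXM eqxx scale0r add0r; congr (_ + _).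
    rewrite mulr_sumr; apply: eq_bigr => l _.
    by rewrite /bump /= add1n coefXM /= subSS exprS -mulrA scalerAr.
  rewrite big_ord_recr /= coefCM (nth_default _ sP) mulr0 scale0r addr0.
  rewrite mulr_sumr; apply: eq_bigr => l _.
  rewrite coefCM subSn -1?ltnS // exprS -scalerAl -scalerAr scalerA.
  by rewrite mulrCA.
have hom1 N : hom N 1 = y ^+ N.
  rewrite /hom big_ord_recl coef1 scale1r expr0 mul1r subn0 big1 ?addr0 // => l _.
  by rewrite coef1 scale0r.
have sz (P : {poly F}) (c : F) N :
    (size P <= N)%N -> (size (('X + c%:P) * P)%R <= N.+1)%N.
  move=> sP; apply: leq_trans (size_polyMleq _ _) _.
  by rewrite size_XaddC.
rewrite -/(hom (j + i)%N (('X + 1) ^+ j * ('X - 1) ^+ i)).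
suff [] : (size (('X + 1) ^+ j * ('X - 1) ^+ i : {poly F})%R <= (j + i).+1)%N /\
  (x + y) ^+ j * (x - y) ^+ i = hom (j + i)%N (('X + 1) ^+ j * ('X - 1) ^+ i).
  by [].
have -> : ('X - 1 : {poly F}) = 'X + (-1)%:P by rewrite polyCN.
have -> : ('X + 1 : {poly F}) = 'X + 1%:P by [].
have -> : x - y = x + (-1) *: y by rewrite scaleN1r.
have {1}-> : x + y = x + (1 *: y) by rewrite scale1r.
elim: j => [|j [IHs IH]].
  rewrite !expr0 !mul1r; elim: i => [|i [IHs IH]].
    by rewrite !expr0 size_poly1 hom1 expr0.
  by rewrite add0n in IHs IH *; rewrite !exprS homS // IH; split=> //; apply: sz.
rewrite addSn !exprS -!mulrA homS // IH; split=> //; exact: sz IHs.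
Qed.

(** Both sides are the coefficient of s^j t^i in (st + s + t - 1)^n, which is
    symmetric in s and t and equal to ((t+1) s + (t-1))^n. *)
Lemma kraw_reciprocity n i j : (i <= n)%N -> (j <= n)%N ->
  'C(n, j)%:R * kraw j (n - j) i = 'C(n, i)%:R * kraw i (n - i) j.
Proof.
pose W : {poly {poly F}} := ('X + 1)%:P * 'X + ('X - 1)%:P.
have coefW m l : ((W ^+ n)`_m)`_l = if (m <= n)%N then 'C(n, m)%:R * kraw m (n - m) l else 0.
  rewrite /W addrC exprDn coef_sum.
  have E (s : 'I_n.+1) : true -> ((('X - 1)%:P ^+ (n - s) * (('X + 1)%:P * 'X) ^+ s
      : {poly {poly F}}) *+ 'C(n, s))`_m =
    if m == s then 'C(n, s)%:R *: (('X + 1) ^+ s * ('X - 1) ^+ (n - s)) else 0.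
    move=> _; rewrite coefMn exprMn -!rmorphXn mulrA -rmorphM coefCM coefXn.
    by case: eqP => _; rewrite ?mulr0 ?mul0rn // mulr1 mulrC -scaler_nat.
  rewrite (eq_bigr _ E) -big_mkcond /=; case: leqP => lt_mn; last first.
    by rewrite big1 ?coef0 // => s /eqP ms; move: lt_mn; rewrite ms ltnNge -ltnS ltn_ord.
  by rewrite -ltnS in lt_mn; rewrite (big_pred1 (Ordinal lt_mn)) ?coefZ // => s; rewrite eq_sym.
have swapW : swapXY W = W.
  rewrite /W rmorphD rmorphM /= swapXY_X !swapXY_polyC.
  by rewrite !(rmorphD, rmorphB, rmorph1, rmorphN) /= !map_polyX; ring.
move=> le_in le_jn; have := coef_swapXY (W ^+ n) i j.
by rewrite rmorphXn /= swapW !coefW le_in le_jn.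
Qed.

End Krawtchouk.

(** * The trace of the product of the two torus projectors in characteristic p *)

Lemma sum_prim_root (F : fieldType) n (w : F) s t : n.-primitive_root w ->
  \sum_(i < n) (w ^+ i) ^+ s / (w ^+ i) ^+ t = if s == t %[mod n] then n%:R else 0.
Proof.
move=> w_prim; have w0 : w != 0 by rewrite (prim_root_eq0 w_prim) -lt0n (prim_order_gt0 w_prim).
have E (i : 'I_n) : true -> (w ^+ i) ^+ s / (w ^+ i) ^+ t = (w ^+ s / w ^+ t) ^+ i.
  by move=> _; rewrite exprMn exprVn -!exprM mulnC (mulnC i).
rewrite (eq_bigr _ E) -(eq_prim_root_expr w_prim).
have [st|st] := eqVneq (w ^+ s) (w ^+ t).
  rewrite st divff ?expf_neq0 //; under eq_bigr do rewrite expr1n.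
  by rewrite sumr_const card_ord.
have r1 : w ^+ s / w ^+ t - 1 != 0.
  by rewrite subr_eq0 -(inj_eq (mulIf (expf_neq0 t w0))) divfK ?expf_neq0 // mul1r.
apply: (mulfI r1); rewrite mulr0 -subrX1 exprMn exprVn -!exprM !(mulnC _ n) !exprM.
by rewrite (prim_expr_order w_prim) !expr1n divr1 subrr.
Qed.

Lemma predn_sqr n : (n ^ 2).-1 = (n.-1 * n.+1)%N.
Proof. by case: n => // n; rewrite -subn1 -[X in (_ - X)%N](exp1n 2) subn_sqr subn1 addn1. Qed.

Section CharP.
Variables (k : fieldType) (p : nat).
Hypothesis charp : p \in [pchar k].

Lemma bin_neq0 m l : (m < p)%N -> (l <= m)%N -> 'C(m, l)%:R != 0 :> k.
Proof.
move=> lt_mp le_lm; have p_pr := pcharf_prime charp.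
have fact_ndvd : ~~ (p %| m`!)%N.
  elim: m lt_mp {le_lm} => [|m IHm] lt_mp; first by rewrite fact0 dvdn1 gtn_eqF ?prime_gt1.
  by rewrite factS Euclid_dvdM // negb_or gtnNdvd // IHm // ltnW.
rewrite -(dvdn_pcharf charp); apply: contra fact_ndvd => dvd_p.
by rewrite -(bin_fact le_lm) dvdn_mulr.
Qed.

(** The polynomial is (X^2 - 1)^m times X + 1 or X - 1, so there is no cancellation
    and each coefficient is a binomial coefficient up to sign. *)
Lemma kraw_near_middle m (d : bool) j : (m < p)%N -> (j <= m.*2.+1)%N ->
  kraw k (m + d) (m + ~~ d) j != 0.
Proof.
move=> lt_mp le_j.
have coefm i : (i <= m)%N -> (('X - 1 : {poly k}) ^+ m)`_i != 0.
  move=> le_im; rewrite -[- 1]polyCN -/(polyC _) addrC exprDn coef_sum.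
  rewrite (bigD1 (Ordinal (le_im : i < m.+1)%N)) //= big1 => [|s /negPf s_i].
    rewrite addr0 coefMn -rmorphXn coefCM coefXn eqxx mulr1 -mulr_natr.
    by rewrite mulf_neq0 ?bin_neq0 // expf_neq0 // oppr_eq0 oner_eq0.
  rewrite coefMn -rmorphXn coefCM coefXn.
  by move: s_i; rewrite -val_eqE eq_sym /= => ->; rewrite mulr0 mul0rn.
have -> : kraw k (m + d) (m + ~~ d) j =
    ((('X - 1) ^+ m \Po 'X^2) * ('X + ((-1) ^+ (~~ d))%:P) : {poly k})`_j.
  rewrite /kraw !exprD mulrACA -exprMn rmorphXn rmorphB rmorph1 /= comp_polyX.
  rewrite [('X + 1) * _](_ : _ = 'X^2 - 1); last by ring.
  by case: d; rewrite /= ?expr0 ?expr1 ?polyCN ?mulr1 ?mul1r.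
rewrite mulrDr coefD coefMX coefMC !coef_comp_poly_Xn // !dvdn2 !divn2.
case: j le_j => [|j] le_j /=.
  by rewrite add0r mulf_neq0 ?coefm // expf_neq0 // oppr_eq0 oner_eq0.
rewrite negbK; have jm : (j.+1./2 <= m)%N by lia.
have jm' : (j./2 <= m)%N by lia.
case: (odd j) => /=; last by rewrite mul0r addr0 coefm.
by rewrite add0r mulf_neq0 ?coefm // expf_neq0 // oppr_eq0 oner_eq0.
Qed.

Lemma prim_norm (g : k) :
  (p ^ 2).-1.-primitive_root g -> p.-1.-primitive_root (g ^+ p.+1).
Proof.
have p_gt1 := prime_gt1 (pcharf_prime charp); move=> g_prim.
have := @dvdn_prim_root _ _ _ g_prim p.-1.
by rewrite predn_sqr dvdn_mulr // mulKn; [apply | rewrite -ltnS prednK // ltnW].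
Qed.

Lemma prim_ratio (g : k) :
  (p ^ 2).-1.-primitive_root g -> p.+1.-primitive_root (g ^+ p.-1).
Proof.
move=> g_prim; have := @dvdn_prim_root _ _ _ g_prim p.+1.
by rewrite predn_sqr dvdn_mull // mulnK //; apply.
Qed.

Hypothesis p_odd : odd p.

(** In a basis that diagonalizes the nonsplit torus, diag(x, 1) has the matrix
    with diagonal entries (x+1)/2 and off-diagonal entries (x-1)/2; this is its
    j-th diagonal coefficient on Sym^(N-1). *)
Definition split_coef (x : k) (N j : nat) : k :=
  ((((x + 1) / 2) *: 'X + ((x - 1) / 2)%:P) ^+ j *
   (((x - 1) / 2) *: 'X + ((x + 1) / 2)%:P) ^+ (N.-1 - j))`_j.

Lemma two_neq0 : 2 != 0 :> k.
Proof.
rewrite -(dvdn_pcharf charp) gtnNdvd //; have := prime_gt1 (pcharf_prime charp).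
by move: p_odd; case: (p) => [|[|[|]]].
Qed.

(** The arguments of [lucas] are the trace and the determinant of z diag(x, 1),
    which has rows (z u, z v) and (z^p v, z^p u) in the basis diagonalizing z,
    for u = (x+1)/2 and v = (x-1)/2. *)
Lemma lucas_torus z x N :
  lucas ((z + z ^+ p) * (x + 1) / 2) (z ^+ p.+1 * x) N =
    \sum_(j < N) z ^+ (j + p * (N.-1 - j)) * split_coef x N j.
Proof.
have two := two_neq0.
set u := (x + 1) / 2; set v := (x - 1) / 2.
have -> : (z + z ^+ p) * (x + 1) / 2 = z * u + z ^+ p * u.
  by rewrite -mulrA -/u mulrDl.
have -> : z ^+ p.+1 * x = (z * u) * (z ^+ p * u) - (z * v) * (z ^+ p * v).
  by rewrite exprS /u /v; field.
rewrite lucas_sym_trace; apply: eq_bigr => j _.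
rewrite /split_coef -/u -/v; clearbody u v.
rewrite -!scalerA !polyCM !mul_polyC -!scalerDr !exprZn -scalerAl -scalerAr.
by rewrite !coefZ mulrA -exprM -exprD.
Qed.

Lemma split_coef_expand x n j : (j <= n)%N ->
  2 ^+ n * split_coef x n.+1 j =
    \sum_(l < n.+1) x ^+ l * (kraw k j (n - j) l * kraw k l (n - l) j).
Proof.
move=> le_jn; have half c : 2 * (c / 2) = c :> k by rewrite mulrC divfK ?two_neq0.
have -> : 2 ^+ n * split_coef x n.+1 j =
    ((x *: ('X + 1) + ('X - 1)) ^+ j * (x *: ('X + 1) - ('X - 1)) ^+ (n - j))`_j.
  have -> : x *: ('X + 1) + ('X - 1) = 2 *: (((x + 1) / 2) *: 'X + ((x - 1) / 2)%:P) :> {poly k}.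
    rewrite [RHS]scalerDr [in RHS]scalerA half -[2 *: _]mul_polyC -polyCM half.
    by rewrite -!mul_polyC !(polyCB, polyCD); ring.
  have -> : x *: ('X + 1) - ('X - 1) = 2 *: (((x - 1) / 2) *: 'X + ((x + 1) / 2)%:P) :> {poly k}.
    rewrite [RHS]scalerDr [in RHS]scalerA half -[2 *: _]mul_polyC -polyCM half.
    by rewrite -!mul_polyC !(polyCB, polyCD); ring.
  by rewrite !exprZn -scalerAl -scalerAr scalerA coefZ -exprD subnKC.
rewrite kraw_homog coef_sum subnKC //; apply: eq_bigr => l _.
by rewrite exprZn -scalerAl !coefZ /kraw mulrCA.
Qed.

Variable g : k.
Hypothesis g_prim : (p ^ 2).-1.-primitive_root g.

(** The sum of z^-kappa x^-m times the trace of z diag(x, 1) on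
    Sym^(N-1) (x) det^c, where z runs over representatives of F_(p^2)^x / F_p^x
    and x over F_p^x; these groups are generated by g and by its norm g^(p+1). *)
Definition torus_sum (kappa m c N : nat) : k :=
  \sum_(i < p.+1) \sum_(e < p.-1)
    ((g ^+ i) ^+ kappa)^-1 * (((g ^+ p.+1) ^+ e) ^+ m)^-1 *
    ((((g ^+ i) ^+ p.+1) * (g ^+ p.+1) ^+ e) ^+ c *
     lucas ((g ^+ i + (g ^+ i) ^+ p) * ((g ^+ p.+1) ^+ e + 1) / 2)
           ((g ^+ i) ^+ p.+1 * (g ^+ p.+1) ^+ e) N).

(** The nonsplit torus acts on Sym^(N-1) (x) det^c by the characters of exponents
    (p+1) c + j + p (N-1-j), and summing over z extracts those congruent to
    kappa.  All of them agree on F_p^x, hence the parametrization by [f]. *)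
Lemma torus_sumE (c0 l m c N : nat) (f : nat -> nat) :
  (forall j, (j < N)%N -> p.+1 * c + (j + p * (N.-1 - j)) = c0 + p.-1 * f j)%N ->
  torus_sum (c0 + p.-1 * l) m c N =
    \sum_(j < N | f j == l %[mod p.+1])
      \sum_(e < p.-1) ((g ^+ p.+1) ^+ e) ^+ c / ((g ^+ p.+1) ^+ e) ^+ m *
         split_coef ((g ^+ p.+1) ^+ e) N j.
Proof.
move=> fE; rewrite /torus_sum.
have g0 : g != 0.
  by rewrite (prim_root_eq0 g_prim) -lt0n (prim_order_gt0 g_prim).
pose w := g ^+ p.-1.
transitivity (\sum_(j < N) (\sum_(i < p.+1) (w ^+ i) ^+ f j / (w ^+ i) ^+ l) *
   \sum_(e < p.-1) ((g ^+ p.+1) ^+ e) ^+ c / ((g ^+ p.+1) ^+ e) ^+ m *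
         split_coef ((g ^+ p.+1) ^+ e) N j).
  under [RHS]eq_bigr do rewrite mulr_suml.
  rewrite [RHS]exchange_big; apply: eq_bigr => i _.
  under [RHS]eq_bigr do rewrite mulr_sumr.
  rewrite [RHS]exchange_big; apply: eq_bigr => e _.
  rewrite lucas_torus !mulr_sumr; apply: eq_bigr => j _.
  set z := g ^+ i; set x := (g ^+ p.+1) ^+ e.
  have z0 : z != 0 by rewrite expf_neq0.
  have -> : w ^+ i = z ^+ p.-1 by rewrite /w /z exprAC.
  have -> : (z ^+ p.-1) ^+ f j / (z ^+ p.-1) ^+ l =
      z ^+ (p.+1 * c + (j + p * (N.-1 - j))) / z ^+ (c0 + p.-1 * l).
    rewrite fE // !exprD -!exprM invfM mulrACA divff ?mul1r //.
    by rewrite expf_neq0.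
  rewrite exprMn [z ^+ (p.+1 * c + _)]exprD [z ^+ (p.+1 * c)]exprM.
  move: (_ ^+ (c0 + _)) (_ ^+ (j + _)) (x ^+ m) (x ^+ c) (_ ^+ c) => A B C D E.
  by move: (split_coef _ _ _) => S; ring.
under eq_bigr do rewrite (sum_prim_root _ _ (prim_ratio g_prim)).
rewrite [RHS]big_mkcond; apply: eq_bigr => j _; case: ifP => _; last by rewrite mul0r.
by rewrite -natr1 (pcharf0 charp) add0r mul1r.
Qed.

Lemma torus_sum_eq0 (c0 l m c N : nat) (f : nat -> nat) :
  (forall j, (j < N)%N -> p.+1 * c + (j + p * (N.-1 - j)) = c0 + p.-1 * f j)%N ->
  (forall j, (j < N)%N -> f j != l %[mod p.+1]) ->
  torus_sum (c0 + p.-1 * l) m c N = 0.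
Proof.
move=> fE f_l; rewrite (torus_sumE _ _ fE) big1 // => j fj.
by have := f_l j (ltn_ord j); rewrite fj.
Qed.

(** If exactly one weight j0 of the nonsplit torus matches, summing over x
    extracts the coefficient of x^i0 in [split_coef], a product of two Krawtchouk
    coefficients.  Here N - 1 is odd and i0 is one of the two integers nearest to
    (N-1)/2. *)
Lemma torus_sum_neq0 (c0 l i0 j0 c N : nat) (f : nat -> nat) :
  (forall j, (j < N)%N -> p.+1 * c + (j + p * (N.-1 - j)) = c0 + p.-1 * f j)%N ->
  (forall j, (j < N)%N -> (f j == l %[mod p.+1]) = (j == j0)) ->
  (N < p)%N -> (j0 < N)%N -> ~~ odd N -> (i0 == N./2) || (i0.+1 == N./2) ->
  torus_sum (c0 + p.-1 * l) (c + i0) c N != 0.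
Proof.
move=> fE f_l lt_Np lt_j0 N_even i0_mid.
have g0 : g != 0.
  by rewrite (prim_root_eq0 g_prim) -lt0n (prim_order_gt0 g_prim).
rewrite (torus_sumE _ _ fE) (eq_bigl (fun j => j == Ordinal lt_j0)); last first.
  by move=> j; rewrite f_l.
rewrite big_pred1_eq /=; case: N => // n in fE f_l lt_Np lt_j0 N_even i0_mid *.
have lt_i0 : (i0 < n.+1)%N by lia.
have half_n : n = n./2.*2.+1 by lia.
apply: contraTneq (oner_neq0 k) => sum0; rewrite negbK.
have : 2 ^+ n * (\sum_(e < p.-1) ((g ^+ p.+1) ^+ e) ^+ c / ((g ^+ p.+1) ^+ e) ^+ (c + i0) *
         split_coef ((g ^+ p.+1) ^+ e) n.+1 j0) = 0 by rewrite sum0 mulr0.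
have -> : 2 ^+ n * (\sum_(e < p.-1) ((g ^+ p.+1) ^+ e) ^+ c / ((g ^+ p.+1) ^+ e) ^+ (c + i0) *
         split_coef ((g ^+ p.+1) ^+ e) n.+1 j0) =
   \sum_(l < n.+1) (\sum_(e < p.-1) ((g ^+ p.+1) ^+ e) ^+ l / ((g ^+ p.+1) ^+ e) ^+ i0) *
      (kraw k j0 (n - j0) l * kraw k l (n - l) j0).
  under [RHS]eq_bigr do rewrite mulr_suml.
  rewrite [RHS]exchange_big mulr_sumr; apply: eq_bigr => e _.
  rewrite mulrCA split_coef_expand // mulr_sumr; apply: eq_bigr => s _.
  set x := (g ^+ p.+1) ^+ e; have x0 : x != 0 by rewrite !expf_neq0.
  move: (expf_neq0 c x0) (expf_neq0 i0 x0); rewrite exprD.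
  move: (x ^+ c) (x ^+ i0) (x ^+ s) (_ * kraw _ _ _ _) => A B D S A0 B0.
  by field; rewrite A0 B0.
under eq_bigr do rewrite (sum_prim_root _ _ (prim_norm g_prim)).
rewrite (bigD1 (Ordinal lt_i0)) //= eqxx big1 => [|s s_i]; last first.
  rewrite ifN ?mul0r // !modn_small; first by rewrite -val_eqE in s_i.
    by lia.
  by have := ltn_ord s; lia.
have pm1 : p.-1%:R = -1 :> k.
  apply/eqP; rewrite -addr_eq0 natr1 prednK ?(pcharf0 charp) //.
  exact: prime_gt0 (pcharf_prime charp).
have rec := @kraw_reciprocity k n i0 j0 lt_i0 lt_j0.
have mid : kraw k i0 (n - i0) j0 != 0.
  have le_j0 : (j0 <= n./2.*2.+1)%N by lia.
  have := @kraw_near_middle n./2 (i0 == n./2.+1) j0 _ le_j0.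
  have -> : (n./2 + (i0 == n./2.+1) = i0)%N by lia.
  have -> : (n./2 + (i0 != n./2.+1) = n - i0)%N by lia.
  by apply; lia.
move/eqP; rewrite addr0 pm1 mulN1r oppr_eq0 mulf_eq0 (negPf mid) orbF => /eqP z.
move/eqP: rec; rewrite z mulr0 eq_sym mulf_eq0 (negPf mid) orbF.
by rewrite (negPf (bin_neq0 _ _)) //; lia.
Qed.

(** The trace of an element of trace t and determinant delta on the reduction
    modulo p of the cuspidal representation of labels a, b, which is the sum of
    Sym^(a-b-2) (x) det^(b+1) and Sym^(p-1-(a-b)) (x) det^a.  For a - b = 1 the
    first term vanishes, as it should. *)
Definition brauer_trace (a b : nat) (t delta : k) : k :=
  delta ^+ b.+1 * lucas t delta (a - b).-1 + delta ^+ a * lucas t delta (p - (a - b)).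

(** The exponents that agree with a + p b on F_p^x are a + p b + (p-1) l.  The
    values 0 < l < a - b are those of the first summand and a - b < l <= p those
    of the second one. *)
Lemma torus_brauer_sum_neq0 (a b l m : nat) :
  (b < a)%N -> (a < p)%N -> odd (a + b) -> (0 < l <= p)%N ->
  (l < a - b)%N && (m == (a + b - 1) %/ 2)%N
    || (a - b < l)%N && (m == (a + b + p) %/ 2)%N ->
  \sum_(i < p.+1) \sum_(e < p.-1)
    ((g ^+ i) ^+ (a + p * b + p.-1 * l))^-1 * (((g ^+ p.+1) ^+ e) ^+ m)^-1 *
    brauer_trace a b ((g ^+ i + (g ^+ i) ^+ p) * ((g ^+ p.+1) ^+ e + 1) / 2)
           ((g ^+ i) ^+ p.+1 * (g ^+ p.+1) ^+ e) != 0.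
Proof.
move=> lt_ba lt_ap ab_odd /andP[l_gt0 le_lp] cases.
set S := (X in X != 0).
have -> : S = torus_sum (a + p * b + p.-1 * l) m b.+1 (a - b).-1
   + torus_sum (a + p * b + p.-1 * l) m a (p - (a - b)).
  rewrite /S /torus_sum -big_split; apply: eq_bigr => i _.
  by rewrite -big_split; apply: eq_bigr => e _; rewrite /= -mulrDr.
have E1 j : (j < (a - b).-1)%N -> (p.+1 * b.+1 + (j + p * ((a - b).-1.-1 - j)) =
     a + p * b + p.-1 * ((a - b).-1 - j))%N.
  have [s ->] : exists s, a = (b + s)%N by exists (a - b)%N; lia.
  rewrite addKn => lt_j; have [r sE] : exists r, s = (j + r + 2)%N by exists (s - j - 2)%N; lia.
  have [q ->] : exists q, p = q.+1 by exists p.-1; lia.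
  have -> : (s.-1.-1 - j = r)%N by lia.
  have -> : (s.-1 - j = r.+1)%N by lia.
  by rewrite sE /=; ring.
have E2 j : (j < p - (a - b))%N -> (p.+1 * a + (j + p * ((p - (a - b)).-1 - j)) =
     a + p * b + p.-1 * (p - j))%N.
  have [s ->] : exists s, a = (b + s)%N by exists (a - b)%N; lia.
  rewrite addKn => lt_j; have [r pE] : exists r, p = (s + j + r).+1 by exists (p - s - j).-1; lia.
  have -> : ((p - s).-1 - j = r)%N by lia.
  have -> : (p - j = s + r.+1)%N by lia.
  by rewrite pE /=; ring.
case/orP: cases => /andP[l_ab /eqP mE].
  rewrite [X in _ + X](torus_sum_eq0 _ E2) ?addr0.
    have -> : m = (b.+1 + (m - b.+1))%N by lia.
    apply: (torus_sum_neq0 (j0 := ((a - b).-1 - l)%N) E1) => [j lt_j||||]; try lia.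
    by rewrite !modn_small; lia.
  by move=> j lt_j; rewrite !modn_small; lia.
rewrite (torus_sum_eq0 _ E1) ?add0r.
  have -> : m = (a + (m - a))%N by lia.
  apply: (torus_sum_neq0 (j0 := (p - l)%N) E2) => [j lt_j||||]; try lia.
  by rewrite !modn_small; lia.
by move=> j lt_j; rewrite !modn_small; lia.
Qed.

End CharP.

(** * Idempotents, and projectors on eigenspaces of a cyclic group *)

Lemma mxtrace_idempotent (F : fieldType) n (A : 'M[F]_n) :
  A *m A = A -> \tr A = (\rank A)%:R.
Proof.
move=> AA; have CR := mulmx_base A.
have RC : row_base A *m col_base A = 1%:M.
  apply: (row_free_inj (row_base_free A)); rewrite mul1mx.
  apply: (row_full_inj (col_base_full A)).
  by rewrite -[row_base A *m _ *m _]mulmxA CR mulmxA CR.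
by rewrite -[in LHS]CR mxtrace_mulC RC mxtrace1.
Qed.

Lemma idempotent_trace1 (F : numFieldType) n (A : 'M[F]_n) (w : 'cV[F]_n) :
  A *m A = A -> \tr A = 1 -> A *m w = w -> w != 0 -> exists u : 'rV_n, A = w *m u.
Proof.
move=> AA trA Aw w0; have rkA : \rank A^T = 1%N.
  apply/eqP; rewrite mxrank_tr -(Num.Theory.eqr_nat F) -(mxtrace_idempotent AA); exact/eqP.
have wA : (w^T <= A^T)%MS by rewrite -Aw trmx_mul submxMl.
have : (A^T <= w^T)%MS.
  rewrite -(mxrank_leqif_sup wA).2 rkA rank_rV.
  by rewrite -(inj_eq trmx_inj) trmxK trmx0 w0.
case/submxP=> D AD; exists D^T.
by apply: trmx_inj; rewrite trmx_mul trmxK.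
Qed.

Section CyclicProjector.
Variables (F : fieldType) (gT : finGroupType) (G : {group gT}) (d : nat).
Variables (rG : mx_representation F G d) (n : nat) (y : gT).
Hypotheses (Gy : y \in G) (n_neq0 : n%:R != 0 :> F).

(** If the n-th power of [y] acts by the scalar lam^n, this is the projector on the
    lam-eigenspace of [y]. *)
Definition cyclic_proj (lam : F) : 'M[F]_d :=
  n%:R^-1 *: \sum_(i < n) (lam ^+ i)^-1 *: rG (y ^+ i)%g.

Lemma cyclic_projE (lam : F) (B : 'M_d) :
  \tr (cyclic_proj lam *m B) = n%:R^-1 * \sum_(i < n) (lam ^+ i)^-1 * \tr (rG (y ^+ i)%g *m B).
Proof.
rewrite /cyclic_proj -scalemxAl mxtraceZ mulmx_suml raddf_sum; congr (_ * _).
by apply: eq_bigr => i _; rewrite -scalemxAl /= mxtraceZ.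
Qed.

Lemma cyclic_proj_id m lam (w : 'M_(d, m)) :
  lam != 0 -> rG y *m w = lam *: w -> cyclic_proj lam *m w = w.
Proof.
move=> lam0 yw; have yiw i : rG (y ^+ i)%g *m w = lam ^+ i *: w.
  elim: i => [|i IHi]; first by rewrite expg0 repr_mx1 mul1mx expr0 scale1r.
  by rewrite expgSr repr_mxM ?groupX // -mulmxA yw -scalemxAr IHi scalerA exprS.
rewrite /cyclic_proj -scalemxAl mulmx_suml (eq_bigr (fun=> w)) => [|i _].
  by rewrite sumr_const card_ord -scaler_nat scalerA mulVf // scale1r.
by rewrite -scalemxAl yiw scalerA mulVf ?scale1r // expf_neq0.
Qed.

Lemma cyclic_proj_eigen lam : lam != 0 -> rG (y ^+ n)%g = (lam ^+ n)%:M ->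
  rG y *m cyclic_proj lam = lam *: cyclic_proj lam.
Proof.
move=> lam0 yn; pose f i := (lam ^+ i)^-1 *: rG (y ^+ i)%g.
have n_gt0 : (0 < n)%N by rewrite lt0n; apply: contraNneq n_neq0 => ->.
rewrite /cyclic_proj -scalemxAr scalerA mulrC -scalerA; congr (_ *: _).
rewrite mulmx_sumr scaler_sumr.
have -> : \sum_(i < n) rG y *m f i = \sum_(i < n) lam *: f i.+1.
  apply: eq_bigr => i _; rewrite /f -scalemxAr -repr_mxM ?groupX // -expgS scalerA.
  by rewrite exprS invfM mulrA divff // mul1r.
rewrite -!scaler_sumr; congr (_ *: _).
case: (n) n_gt0 yn => // n' _ yn; rewrite big_ord_recr big_ord_recl addrC.
congr (_ + _); rewrite /f yn expr0 expg0 invr1 scale1r repr_mx1 -[in LHS]scalemx1.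
by rewrite scalerA mulVf ?scale1r // expf_neq0.
Qed.

Lemma cyclic_proj_eigenX lam i : lam != 0 -> rG (y ^+ n)%g = (lam ^+ n)%:M ->
  rG (y ^+ i)%g *m cyclic_proj lam = lam ^+ i *: cyclic_proj lam.
Proof.
move=> lam0 yn; elim: i => [|i IHi].
  by rewrite expg0 repr_mx1 mul1mx expr0 scale1r.
rewrite expgSr repr_mxM ?groupX // -mulmxA cyclic_proj_eigen // -scalemxAr IHi.
by rewrite scalerA exprS.
Qed.

Lemma sum_cyclic_proj lam zeta : lam != 0 -> n.-primitive_root zeta ->
  \sum_(l < n) cyclic_proj (lam * zeta ^+ l) = 1%:M.
Proof.
move=> lam0 zeta_prim; have n_gt0 := prim_order_gt0 zeta_prim.
rewrite /cyclic_proj -scaler_sumr exchange_big /=.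
have E (i : 'I_n) : true -> \sum_(l < n) ((lam * zeta ^+ l) ^+ i)^-1 *: rG (y ^+ i)%g =
    if 0 == i %[mod n] then n%:R *: ((lam ^+ i)^-1 *: rG (y ^+ i)%g) else 0.
  move=> _; rewrite -scaler_suml.
  have -> : \sum_(l < n) ((lam * zeta ^+ l) ^+ i)^-1 =
     (lam ^+ i)^-1 * \sum_(l < n) (zeta ^+ l) ^+ 0 / (zeta ^+ l) ^+ i.
    by rewrite mulr_sumr; apply: eq_bigr => l _; rewrite exprMn invfM expr0 mul1r.
  by rewrite sum_prim_root //; case: ifP; rewrite ?mulr0 ?scale0r // mulrC scalerA.
rewrite (eq_bigr _ E) -big_mkcond (big_pred1 (Ordinal n_gt0)) /=.
  by rewrite expr0 expg0 repr_mx1 invr1 scale1r scalerA mulVf // scale1r.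
by move=> i; rewrite /= !modn_small // eq_sym.
Qed.

End CyclicProjector.

(** * Two-by-two matrices *)

Section Mx2.
Variable R : comNzRingType.
Implicit Types a b c d : R.

Lemma mx2_eta (A : 'M[R]_2) : A = mx2 (A 0 0) (A 0 1) (A 1 0) (A 1 1).
Proof.
by apply/matrixP=> i j; rewrite mxE; case: i j => [[|[|i]] ?] [[|[|j]] ?] //=;
  congr (A _ _); apply: val_inj.
Qed.

Lemma mulmx2 a b c d a' b' c' d' : mx2 a b c d *m mx2 a' b' c' d' =
  mx2 (a * a' + b * c') (a * b' + b * d') (c * a' + d * c') (c * b' + d * d').
Proof.
by apply/matrixP=> i j; rewrite !mxE !big_ord_recl big_ord0 !mxE;
  case: i j => [[|[|i]] ?] [[|[|j]] ?] //=; rewrite addr0.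
Qed.

Lemma mirabolicM a b c d :
  mx2 a b 0 1 *m mx2 c d 0 1 = mx2 (a * c) (a * d + b) 0 1.
Proof. by rewrite mulmx2; congr mx2; ring. Qed.

Lemma mxtrace2 a b c d : \tr (mx2 a b c d) = a + d.
Proof. by rewrite /mxtrace !big_ord_recl big_ord0 !mxE /= addr0. Qed.

Lemma det_mx2 a b c d : \det (mx2 a b c d) = a * d - b * c.
Proof.
rewrite (expand_det_row _ 0) !big_ord_recl big_ord0 /cofactor !det_mx11 !mxE /=.
by rewrite /bump /= addr0 expr0 expr1 mul1r mulN1r mulrN.
Qed.

Lemma scalar_mx2 a : a%:M = mx2 a 0 0 a.
Proof.
by apply/matrixP=> i j; rewrite !mxE; case: i j => [[|[|i]] ?] [[|[|j]] ?].
Qed.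

End Mx2.

Lemma char_poly_mx2 (R : comNzRingType) (a b c d : R) :
  char_poly (mx2 a b c d) = 'X^2 - (a + d) *: 'X + (a * d - b * c)%:P.
Proof.
rewrite /char_poly /char_poly_mx.
rewrite [X in \det X](_ : _ = mx2 ('X - a%:P) (- b%:P) (- c%:P) ('X - d%:P)); last first.
  apply/matrixP=> i j; rewrite !mxE.
  by case: i j => [[|[|i]] ?] [[|[|j]] ?] //=; rewrite ?mulr1n ?mulr0n ?sub0r.
by rewrite det_mx2 -mul_polyC !(polyCB, polyCD, polyCM); ring.
Qed.

Lemma char_poly2 (R : comNzRingType) (A : 'M[R]_2) :
  char_poly A = 'X^2 - \tr A *: 'X + (\det A)%:P.
Proof. by rewrite (mx2_eta A) char_poly_mx2 mxtrace2 det_mx2. Qed.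

Lemma map_mx2 (R S : pzRingType) (f : R -> S) a b c d :
  map_mx f (mx2 a b c d) = mx2 (f a) (f b) (f c) (f d).
Proof.
by apply/matrixP=> i j; rewrite !mxE; case: i j => [[|[|i]] ?] [[|[|j]] ?].
Qed.

(** The columns of Q are an eigenvector (y, lam - x) and a second basis vector;
    when y = 0 exchanging the basis vectors suffices. *)
Lemma triangularize2 (F : fieldType) (A : 'M[F]_2) lam :
  lam ^+ 2 - \tr A * lam + \det A = 0 ->
  exists Q x u y, [/\ Q \in unitmx, Q *m mx2 x u 0 y = A *m Q,
    \tr A = x + y & \det A = x * y].
Proof.
rewrite (mx2_eta A); move: (A 0 0) (A 0 1) (A 1 0) (A 1 1) => {A} x y z t.
rewrite mxtrace2 det_mx2 => lam_root; have [y0|y0] := eqVneq y 0.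
  exists (mx2 0 1 1 0), t, z, x; rewrite y0 !mulmx2; split.
  - by rewrite unitmxE det_mx2 mul0r mulr1 sub0r unitrN unitr1.
  - by congr mx2; ring.
  - by rewrite addrC.
  - by rewrite mul0r subr0 mulrC.
have detE : x * t - y * z = lam * (x + t - lam).
  by apply/eqP; rewrite -subr_eq0; apply/eqP; rewrite -[RHS]lam_root; ring.
exists (mx2 1 0 ((lam - x) / y) 1), lam, y, (x + t - lam); rewrite !mulmx2; split=> //.
- by rewrite unitmxE det_mx2 mulr1 mul0r subr0 unitr1.
- have zE : z = (x * t - lam * (x + t - lam)) / y by rewrite -detE; field.
  by rewrite zE; congr mx2; field.
- by ring.
Qed.

(** * The character of a cuspidal representation *)

Section Cuspidal.
Variables (C : numFieldType) (p : nat) (p_pr : prime p).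
Variables (k : fieldExtType 'F_p) (nu : k -> C).
Variables (rho : mx_representation C 'GL_2(p) p.-1).
Hypothesis rho_cusp : cuspidal_rep nu rho.

Definition gl2 (A : 'M['F_p]_2) : {'GL_2(p)} := insubd (1%g : {'GL_2(p)}) A.

Lemma gl2K A : A \in unitmx -> GLval (gl2 A) = A.
Proof. by move=> uA; rewrite /gl2 insubdK. Qed.

Lemma GLvalK (g : {'GL_2(p)}) : gl2 (GLval g) = g.
Proof. by apply: val_inj; rewrite /= gl2K //; exact: (GL_unit g). Qed.

Lemma gl2M A B : A \in unitmx -> B \in unitmx -> gl2 (A *m B) = (gl2 A * gl2 B)%g.
Proof.
move=> uA uB; apply: val_inj; rewrite /= [LHS]gl2K ?unitmx_mul ?uA //.
by rewrite -[RHS]/(GLval (gl2 A) *m GLval (gl2 B)) !gl2K.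
Qed.

Lemma gl2_1 : gl2 1%:M = 1%g.
Proof. by apply: val_inj; rewrite /= gl2K ?unitmx1. Qed.

Definition mxrep A := rho (gl2 A).

Lemma mxrepM A B : A \in unitmx -> B \in unitmx -> mxrep (A *m B) = mxrep A *m mxrep B.
Proof. by move=> uA uB; rewrite /mxrep gl2M // repr_mxM ?inE. Qed.

Definition mxchar A := \tr (mxrep A).

Lemma mxchar_conj A B Q : Q \in unitmx -> A \in unitmx -> B \in unitmx ->
  Q *m A = B *m Q -> mxchar A = mxchar B.
Proof.
move=> uQ uA uB QA; rewrite /mxchar.
have uQ' : mxrep Q \in unitmx by apply: repr_mx_unit; rewrite inE.
rewrite -[mxrep A](mulKmx uQ') -mxrepM // QA mxrepM // mxtrace_mulC mulmxK //.
Qed.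

Lemma unit_mx2 a b c d : (mx2 a b c d \in unitmx) = (a * d - b * c != 0 :> 'F_p).
Proof. by rewrite unitmxE det_mx2 unitfE. Qed.

Lemma mxchar_scale (c : 'F_p) A : c != 0 -> A \in unitmx ->
  mxchar (c%:M *m A) = nu c%:A * mxchar A.
Proof.
move=> c0 uA; have uc : (c%:M : 'M_2) \in unitmx by rewrite unitmxE det_scalar unitfE expf_neq0.
rewrite /mxchar mxrepM //; case: rho_cusp => _ _ cent _.
by rewrite [mxrep _](cent _ c) ?gl2K // mul_scalar_mx mxtraceZ.
Qed.

Definition unip (u : 'F_p) := mx2 1 u 0 1.

Lemma unit_unip u : unip u \in unitmx.
Proof. by rewrite unit_mx2 mulr0 subr0 mulr1 oner_eq0. Qed.

Lemma unipD u v : unip u *m unip v = unip (v + u).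
Proof. by rewrite /unip mirabolicM !mul1r. Qed.

(** The image of this sum consists of vectors fixed by the unipotent subgroup, and
    cuspidality says that there are none. *)
Lemma sum_unip : \sum_u mxrep (unip u) = 0.
Proof.
set S := \sum_u _; case: rho_cusp => _ fixed0 _ _.
have fixS v : mxrep (unip v) *m S = S.
  rewrite /S mulmx_sumr [RHS](reindex_inj (addIr v)); apply: eq_bigr => u _.
  by rewrite -(mxrepM (unit_unip v) (unit_unip u)) unipD.
apply/matrixP=> i j; rewrite [RHS]mxE.
have: S *m delta_mx j 0 = 0 :> 'cV_ _.
  apply: fixed0 => g u gE; rewrite mulmxA -[g]GLvalK gE.
  by rewrite [_ *m S](fixS u).
by rewrite -colE => /matrixP/(_ i 0); rewrite !mxE.
Qed.

Lemma mxchar1 : mxchar 1%:M = p.-1%:R.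
Proof.
by rewrite /mxchar /mxrep gl2_1 repr_mx1 mxtrace1.
Qed.

Lemma p_neq0 : p%:R != 0 :> C.
Proof. by rewrite Num.Theory.pnatr_eq0 -lt0n prime_gt0. Qed.

(** All the products of diag(x, 1) with unipotent elements are conjugate, and the
    sum of their traces is 0 by [sum_unip]. *)
Lemma mxchar_mirabolic_split (x u : 'F_p) : x != 0 -> x != 1 -> mxchar (mx2 x u 0 1) = 0.
Proof.
move=> x0 x1; have x1' : 1 - x != 0 by rewrite subr_eq0 eq_sym.
have ux v : mx2 x v 0 1 \in unitmx by rewrite unit_mx2 mulr0 subr0 mulr1.
have chE v : mxchar (mx2 x v 0 1) = mxchar (mx2 x 0 0 1).
  apply/esym/(mxchar_conj (unit_unip (v / (1 - x))) (ux 0) (ux v)).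
  rewrite /unip !mirabolicM mul1r mulr1 mulr0 add0r; congr mx2.
  by rewrite -{3}[v](divfK x1'); move: (v / _) => w; ring.
rewrite chE; apply: (mulfI p_neq0); rewrite mulr0.
have: \tr ((\sum_v mxrep (unip v)) *m mxrep (mx2 x 0 0 1)) = 0.
  by rewrite sum_unip mul0mx mxtrace0.
rewrite mulmx_suml raddf_sum /= (eq_bigr (fun=> mxchar (mx2 x 0 0 1))) => [|v _].
  by rewrite sumr_const card_Fp // mulr_natl.
by rewrite -(mxrepM (unit_unip v) (ux 0)) -(chE v) /unip mirabolicM mulr0 add0r mul1r.
Qed.

(** The nontrivial unipotent elements are conjugate, and the trace of [sum_unip] is
    (p - 1) + (p - 1) tr rho(u). *)
Lemma mxchar_unip (u : 'F_p) : u != 0 -> mxchar (unip u) = -1.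
Proof.
move=> u0; have chE v : v != 0 -> mxchar (unip v) = mxchar (unip u).
  move=> v0; have uvu : mx2 (v / u) 0 0 1 \in unitmx.
    by rewrite unit_mx2 mulr0 subr0 mulr1 mulf_neq0 ?invr_eq0.
  apply/esym/(mxchar_conj uvu (unit_unip u) (unit_unip v)).
  by rewrite /unip !mirabolicM mulr1 mul1r mulr0 add0r addr0 divfK.
have p1 : p.-1%:R != 0 :> C.
  by rewrite Num.Theory.pnatr_eq0 -lt0n -ltnS prednK ?prime_gt0 ?prime_gt1.
apply: (mulfI p1).
have: \tr (\sum_v mxrep (unip v)) = 0 by rewrite sum_unip mxtrace0.
rewrite raddf_sum (bigD1 0) //= (eq_bigr (fun=> mxchar (unip u))) => [|v v0]; last exact: chE.
rewrite sumr_const; have -> : #|[pred v : 'F_p | v != 0]| = p.-1.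
  by have := cardC1 (0 : 'F_p); rewrite card_Fp.
rewrite -[\tr _]/(mxchar (unip 0)) [unip 0](_ : _ = 1%:M) ?mxchar1 ?scalar_mx2 //.
by rewrite mulrN1 mulr_natl => /eqP; rewrite addrC addr_eq0 => /eqP.
Qed.

End Cuspidal.

(** * The field with p^2 elements *)

Section QuadraticFiniteField.
Variables (p : nat) (p_pr : prime p) (k : fieldExtType 'F_p).
Hypothesis dim2 : \dim {:k} = 2%N.

Lemma pchar_ext : p \in [pchar k].
Proof. by rewrite pchar_lalg pchar_Fp. Qed.

Lemma Fp_expp (c : 'F_p) : (c%:A : k) ^+ p = c%:A.
Proof. by rewrite -in_algE -rmorphXn -[X in c ^+ X]card_Fp // expf_card. Qed.

Lemma frobD (x y : k) : (x + y) ^+ p = x ^+ p + y ^+ p.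
Proof. by apply: exprDn_pchar; rewrite pnatE //; exact: pchar_ext. Qed.

Lemma frob_fixed (z : k) : z ^+ p = z -> exists c : 'F_p, z = c%:A.
Proof.
move=> zp; have := congr1 (fun f => (map_poly (in_alg k) f).[z]) (finField_genPoly 'F_p).
rewrite card_Fp // rmorphB rmorphXn /= map_polyX hornerD hornerN hornerXn hornerX zp subrr.
rewrite rmorph_prod horner_prod => /esym/eqP; rewrite prodf_seq_eq0 => /hasP[c _ /=].
by rewrite rmorphB /= map_polyX map_polyC hornerXsubC subr_eq0 => /eqP ->; exists c.
Qed.

Local Notation kF := (finvect_type k : finFieldType).

Lemma card_quadratic : #|kF| = (p ^ 2)%N.
Proof.
have := card_vspace (fullv : {vspace kF}); rewrite card_vspacef card_Fp // => ->.
by rewrite -dim2.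
Qed.

Lemma ext_generator : exists g : k, (p ^ 2).-1.-primitive_root g.
Proof.
have cardk := card_quadratic.
have p2 : (1 < p ^ 2)%N by rewrite -(exp1n 2) ltn_exp2r // prime_gt1.
pose rs := enum [pred x : kF | x != 0].
have : has (p ^ 2).-1.-primitive_root (rs : seq kF).
  apply: has_prim_root; first by lia.
  - apply/allP=> x; rewrite /rs mem_enum inE => x0.
    rewrite unity_rootE -(inj_eq (mulfI x0)) -exprS prednK ?mulr1 -?cardk ?expf_card //.
    by lia.
  - exact: enum_uniq.
  by rewrite /rs -cardE -cardk (cardC1 (0 : kF)).
by case/hasP=> g _ g_prim; exists g.
Qed.

Variable g : k.
Hypothesis g_prim : (p ^ 2).-1.-primitive_root g.

Lemma ext_expf (z : k) : z ^+ (p ^ 2) = z.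
Proof.
by rewrite -card_quadratic; apply: (@expf_card kF z).
Qed.

Lemma gen_power (z : k) : z != 0 -> exists i, z = g ^+ i.
Proof.
move=> z0; have [|i ->] := prim_rootP g_prim (x := z); last by exists i.
apply: (mulfI z0); rewrite -exprS prednK ?mulr1 ?ext_expf //.
by rewrite expn_gt0 prime_gt0.
Qed.

(** An element of F_p^x is a power of g^(p+1), and p + 1 is even. *)
Lemma Fp_sqrt (p_odd : odd p) (c : 'F_p) : exists s : k, s ^+ 2 = c%:A.
Proof.
have [->|c0] := eqVneq c 0; first by exists 0; rewrite expr0n scale0r.
have c0' : c%:A != 0 :> k by rewrite scaler_eq0 negb_or c0 oner_eq0.
have [i ci] := gen_power c0'.
have : g ^+ (i * p.-1) == 1.
  rewrite exprM -ci -(inj_eq (mulfI c0')) -exprS prednK ?prime_gt0 //.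
  by rewrite Fp_expp mulr1.
rewrite -(prim_order_dvd g_prim) predn_sqr mulnC dvdn_pmul2r; last first.
  by have := prime_gt1 p_pr; lia.
move=> dvd_i; exists (g ^+ i./2); rewrite -exprM ci muln2.
have : (2 %| i)%N by apply: dvdn_trans dvd_i; rewrite dvdn2 /= p_odd.
by rewrite dvdn2 => i_even; rewrite even_halfK.
Qed.

Lemma norm_gen : exists2 h : 'F_p, h%:A = g ^+ p.+1 & p.-1.-primitive_root h.
Proof.
have [h hE] : exists h : 'F_p, g ^+ p.+1 = h%:A.
  apply: frob_fixed; rewrite -exprM mulSn mulnn addnC exprD.
  by rewrite ext_expf -exprS.
exists h => //; rewrite -(fmorph_primitive_root (in_alg k)) /= -hE.
by have := prim_norm pchar_ext g_prim.
Qed.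

End QuadraticFiniteField.

(** * Values of the modular character *)

Section BrauerTrace.
Variables (k : fieldType) (p : nat).
Variables (a b : nat).
Hypotheses (lt_ba : (b < a)%N) (lt_ap : (a < p)%N).

(** For x, y in F_p the right-hand side vanishes, and for y = x^p of degree two it is
    - (x - y) (x^(a+pb) + x^(b+pa)), in accordance with the values of a cuspidal
    character. *)
Lemma brauer_trace_roots (x y : k) :
  (x - y) * brauer_trace p a b (x + y) (x * y) =
    x ^+ a * y ^+ b.+1 - x ^+ b.+1 * y ^+ a + x ^+ (p + b) * y ^+ a - x ^+ a * y ^+ (p + b).
Proof.
rewrite /brauer_trace mulrDr !(mulrCA (x - y)) !lucas_distinct !mulrBr !exprMn -addrA.
have e1 (z : k) : z ^+ b.+1 * z ^+ (a - b).-1 = z ^+ a by rewrite -exprD; congr (_ ^+ _); lia.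
have e2 (z : k) : z ^+ a * z ^+ (p - (a - b)) = z ^+ (p + b) by rewrite -exprD; congr (_ ^+ _); lia.
rewrite -!e2 -[x ^+ a in RHS]e1 -[y ^+ a in RHS]e1.
have -> : x ^+ b.+1 * x ^+ (a - b).-1 * y ^+ b.+1 - x ^+ b.+1 * (y ^+ b.+1 * y ^+ (a - b).-1)
  = x ^+ b.+1 * y ^+ b.+1 * x ^+ (a - b).-1 - x ^+ b.+1 * y ^+ b.+1 * y ^+ (a - b).-1 by ring.
rewrite !e1; ring.
Qed.

Lemma brauer_trace_double (x : k) : p \in [pchar k] -> x != 0 -> x ^+ p = x ->
  brauer_trace p a b (x + x) (x * x) = - x ^+ (a + b).
Proof.
move=> charp x0 xp; apply: (mulfI x0).
have lucasx n : x * lucas (x + x) (x * x) n = x ^+ n *+ n.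
  by case: n => [|n]; rewrite ?mulr0 // lucas_double mulrnAr -exprS.
rewrite /brauer_trace mulrDr !(mulrCA x) !lucasx !mulrnAr -expr2 -!exprM -!exprD.
have -> : (2 * b.+1 + (a - b).-1 = (a + b).+1)%N by lia.
have -> : (2 * a + (p - (a - b)) = (a + b) + p)%N by lia.
rewrite (exprD x _ p) xp -exprSr -mulrnDr -mulr_natr mulrN -exprS.
have -> : ((a - b).-1 + (p - (a - b)) = p.-1)%N by lia.
have -> : p.-1%:R = -1 :> k.
  apply/eqP; rewrite -addr_eq0 natr1 prednK ?(pcharf0 charp) //.
  exact: prime_gt0 (pcharf_prime charp).
by rewrite mulrN1.
Qed.

End BrauerTrace.

(** * Reduction modulo a prime above p *)

Section Reduction.
Variables (C : fieldType) (p : nat) (P : C -> Prop).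
Hypothesis P_prime : prime_ideal_above p P.
Variables (k : fieldType) (tau : k -> C).
Hypothesis tau_P : teichmuller P tau.

(** The embedding of k in the residue field of [P] is given by its multiplicative
    lift [tau], so that no quotient by [P] has to be formed. *)
Definition reduces_to (x : C) (y : k) : Prop :=
  algebraic_integer x /\ P (x - tau y).

Lemma tau0 : tau 0 = 0. Proof. by case: tau_P. Qed.

Lemma tauM : {morph tau : x y / x * y}.
Proof.
move=> x y; have [-> | x0] := eqVneq x 0; first by rewrite mul0r tau0 mul0r.
have [-> | y0] := eqVneq y 0; first by rewrite mulr0 tau0 mulr0.
by case: tau_P => _ [_ tM] _; apply: tM.
Qed.

Lemma tau_neq0 x : x != 0 -> tau x != 0.
Proof. by case: tau_P => _ [t0 _] _; apply: t0. Qed.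

Lemma tau1 : tau 1 = 1.
Proof.
by apply: (mulfI (tau_neq0 (oner_neq0 k))); rewrite -tauM !mulr1.
Qed.

Lemma tauX n : {morph tau : x / x ^+ n}.
Proof.
by move=> x; elim: n => [|n IHn]; rewrite ?expr0 ?tau1 // !exprS tauM IHn.
Qed.

Lemma tauV : {morph tau : x / x^-1}.
Proof.
move=> x; have [->|x0] := eqVneq x 0; first by rewrite invr0 tau0 invr0.
by apply: (mulfI (tau_neq0 x0)); rewrite -tauM !divff ?tau1 ?tau_neq0.
Qed.

Lemma P0 : P 0.
Proof.
have := prime_aboveM P_prime (integral0 _) (prime_above_p P_prime).
by rewrite mul0r; apply.
Qed.

Hypothesis k_torsion : forall x : k, x != 0 -> exists2 n, (0 < n)%N & x ^+ n = 1.

Lemma tau_integral x : algebraic_integer (tau x).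
Proof.
have [->|x0] := eqVneq x 0; first by rewrite tau0; apply: integral0.
have [n n_gt0 xn] := k_torsion x0; exists ('X^n - 1).
  by rewrite -(polyC1) monicXnsubC.
by rewrite rmorphB rmorphXn rmorph1 /= map_polyX rootE !hornerE -tauX xn tau1 subrr.
Qed.

Lemma PN x : P x -> P (- x).
Proof.
move=> Px; rewrite -mulN1r; apply: (prime_aboveM P_prime) => //.
exact: integral_opp (integral1 _).
Qed.

Lemma reduces_tau y : reduces_to (tau y) y.
Proof. by split; [apply: tau_integral | rewrite subrr; apply: P0]. Qed.

Lemma reduces0 : reduces_to 0 0.
Proof. by rewrite -{1}tau0; apply: reduces_tau. Qed.

Lemma reduces1 : reduces_to 1 1.
Proof. by rewrite -{1}tau1; apply: reduces_tau. Qed.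

Lemma reducesD x x' y y' :
  reduces_to x y -> reduces_to x' y' -> reduces_to (x + x') (y + y').
Proof.
move=> [Ix Px] [Ix' Px']; split; first exact: integral_add.
have [_ _ tD] := tau_P; rewrite (_ : _ - _ = (x - tau y) + (x' - tau y')
   - (tau (y + y') - (tau y + tau y'))); last by ring.
by apply: (prime_aboveD P_prime); [apply: (prime_aboveD P_prime) | apply: PN].
Qed.

Lemma reducesM x x' y y' :
  reduces_to x y -> reduces_to x' y' -> reduces_to (x * x') (y * y').
Proof.
move=> [Ix Px] [Ix' Px']; split; first exact: integral_mul.
rewrite tauM (_ : _ - _ = x' * (x - tau y) + tau y * (x' - tau y')); last by ring.
by apply: (prime_aboveD P_prime); apply: (prime_aboveM P_prime) => //; apply: tau_integral.
Qed.

Lemma reducesN x y : reduces_to x y -> reduces_to (- x) (- y).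
Proof.
move=> rx; have rN1 : reduces_to (-1) (-1).
  split; first exact: integral_opp (integral1 _).
  by have [_ _ /(_ 1 (-1))] := tau_P; rewrite subrr tau0 tau1 sub0r opprD.
by have := reducesM rN1 rx; rewrite !mulN1r.
Qed.

Lemma reduces_nat n : reduces_to n%:R n%:R.
Proof.
by elim: n => [|n IHn]; [apply: reduces0 | rewrite -!natr1; apply: reducesD => //; apply: reduces1].
Qed.

Lemma reduces_sum (I : Type) (r : seq I) (F : I -> C) (G : I -> k) :
  (forall i, reduces_to (F i) (G i)) ->
  reduces_to (\sum_(i <- r) F i) (\sum_(i <- r) G i).
Proof.
move=> FG; apply: (big_ind2 reduces_to) => //; first exact: reduces0.
by move=> *; apply: reducesD.
Qed.

Lemma reduces_neq0 x y : reduces_to x y -> y != 0 -> x != 0.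
Proof.
move=> [_ Px] y0; apply/eqP=> x0; apply: (prime_above_1 P_prime).
have Py : P (tau y) by have := PN Px; rewrite x0 sub0r opprK.
have := prime_aboveM P_prime (tau_integral y^-1) Py.
by rewrite -tauM mulVf // tau1.
Qed.

End Reduction.

(** * The cuspidal character modulo p *)

Section TraceReduction.
Variables (C : numFieldType) (p : nat) (p_pr : prime p) (p_odd : odd p).
Variables (k : fieldExtType 'F_p) (dim2 : \dim {:k} = 2%N).
Variables (P : C -> Prop) (P_prime : prime_ideal_above p P).
Variables (tau : k -> C) (tau_P : teichmuller P tau).
Variables (nu : k -> C) (a b : nat) (lt_ba : (b < a)%N) (lt_ap : (a < p)%N).
Hypothesis nuE : forall z, z != 0 -> nu z = tau z ^+ (a + p * b).
Variables (rho : mx_representation C 'GL_2(p) p.-1) (rho_cusp : cuspidal_rep nu rho).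

Lemma ext_torsion (z : k) : z != 0 -> exists2 n, (0 < n)%N & z ^+ n = 1.
Proof.
move=> z0; exists (p ^ 2).-1.
  by have := prime_gt1 p_pr; rewrite predn_sqr; case: (p) => [|[|]].
apply: (mulfI z0); rewrite -exprS prednK ?mulr1 ?ext_expf //.
by rewrite expn_gt0 prime_gt0.
Qed.

Local Notation redu := (reduces_to P tau).

Lemma mxchar_triangularize (A : 'M['F_p]_2) lam : A \in unitmx ->
  lam ^+ 2 - \tr A * lam + \det A = 0 ->
  exists x u y, [/\ mxchar rho A = mxchar rho (mx2 x u 0 y), \tr A = x + y & \det A = x * y].
Proof.
move=> uA /triangularize2[Q [x [u [y [uQ QE trE detE]]]]].
exists x, u, y; split=> //; apply/esym/(mxchar_conj rho uQ _ uA QE).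
by rewrite unit_mx2 mulr0 subr0 -detE -unitfE -unitmxE.
Qed.

(** Up to the central factor nu(y), the trace is 0, -1 or p - 1 by the values of the
    character on the mirabolic subgroup, and p - 1 is congruent to -1. *)
Lemma mxchar_borel_reduces (x u y : 'F_p) : x != 0 -> y != 0 ->
  redu (mxchar rho (mx2 x u 0 y)) (brauer_trace p a b (x + y)%:A (x * y)%:A).
Proof.
move=> x0 y0; have y0A : y%:A != 0 :> k by rewrite scaler_eq0 negb_or y0 oner_eq0.
have -> : mx2 x u 0 y = y%:M *m mx2 (x / y) (u / y) 0 1.
  by rewrite scalar_mx2 !mulmx2; congr mx2; field.
rewrite (mxchar_scale rho_cusp) //; last first.
  by rewrite unit_mx2 mulr1 mulr0 subr0 mulf_neq0 ?invr_eq0.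
rewrite scalerDl (_ : (x * y)%:A = x%:A * y%:A :> k); last by rewrite -!in_algE rmorphM.
have tors := ext_torsion.
have [xy|xy] := eqVneq x y.
  rewrite xy divff // (brauer_trace_double lt_ba lt_ap) ?pchar_ext ?Fp_expp //.
  rewrite nuE // -(tauX tau_P) -mulrN1.
  have -> : (y%:A : k) ^+ (a + p * b) = y%:A ^+ (a + b).
    by rewrite !exprD exprM Fp_expp.
  apply: (reducesM P_prime tau_P tors); first exact: (reduces_tau P_prime tau_P tors).
  have [->|u0] := eqVneq (u / y) 0.
    rewrite -[mx2 1 0 0 1]scalar_mx2 mxchar1 (_ : -1 = p.-1%:R).
      exact: (reduces_nat P_prime tau_P tors).
    apply/esym/eqP; rewrite -addr_eq0 natr1 prednK ?prime_gt0 //.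
    by rewrite (pcharf0 (pchar_ext p_pr k)).
  rewrite (mxchar_unip p_pr rho_cusp) //.
  apply: (reducesN P_prime tau_P tors); exact: (reduces1 P_prime tau_P tors).
rewrite (mxchar_mirabolic_split p_pr rho_cusp) ?mulf_neq0 ?invr_eq0 //; last first.
  by apply: contra xy => /eqP xy1; rewrite -(divfK y0 x) xy1 mul1r.
rewrite mulr0 (_ : brauer_trace _ _ _ _ _ = 0).
  exact: (reduces0 P_prime tau_P tors).
have xyA : x%:A - y%:A != 0 :> k.
  by rewrite subr_eq0 (inj_eq (fmorph_inj (in_alg k))).
apply: (mulfI xyA); rewrite mulr0 brauer_trace_roots // !exprD !exprS !Fp_expp //.
by ring.
Qed.

(** Both sides depend on the eigenvalues of A only, up to congruence.  The
    eigenvalues are computed from a square root [s] of the discriminant in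
    F_(p^2): they are in F_p, or A is elliptic, according to whether [s] is fixed
    by Frobenius or not. *)
Lemma trace_reduces A : A \in unitmx ->
  redu (mxchar rho A) (brauer_trace p a b (\tr A)%:A (\det A)%:A).
Proof.
move=> uA; have two : 2 != 0 :> k := two_neq0 (pchar_ext p_pr k) p_odd.
have [g g_prim] := ext_generator p_pr dim2.
have [s sE] := Fp_sqrt p_pr dim2 g_prim p_odd ((\tr A) ^+ 2 - 4 * \det A).
pose x := ((\tr A)%:A + s) / 2 : k; pose y := ((\tr A)%:A - s) / 2 : k.
have xDy : (\tr A)%:A = x + y by rewrite /x /y; field.
have xMy : (\det A)%:A = x * y.
  apply: (mulfI (mulf_neq0 two two)); rewrite /x /y.
  transitivity ((\tr A)%:A ^+ 2 - s ^+ 2 : k); last by field.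
  by rewrite sE -!in_algE rmorphB rmorphXn rmorphM rmorph_nat; ring.
have [sp|sp] := eqVneq (s ^+ p) s.
  have [c sc] := frob_fixed p_pr sp.
  have [lam lamE] : exists lam : 'F_p, lam%:A = x.
    exists ((\tr A + c) / 2).
    by rewrite /x sc -!in_algE fmorph_div rmorphD rmorph_nat.
  have [|x' [u [y' [-> -> dE]]]] := @mxchar_triangularize A lam uA.
    apply: (fmorph_inj (in_alg k)).
    by rewrite rmorphD rmorphB rmorphXn rmorphM rmorph0 /= lamE xMy xDy; ring.
  rewrite dE; move: uA; rewrite unitmxE unitfE dE mulf_eq0 negb_or => /andP[? ?].
  exact: mxchar_borel_reduces.
have sN : s ^+ p = - s.
  apply/eqP; rewrite -addr_eq0 -(mulrI_eq0 _ (mulfI _) (x := s ^+ p - s)) ?subr_eq0 //.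
  by rewrite -subr_sqr -exprM mulnC exprM sE Fp_expp // subrr.
have xp : x ^+ p = y.
  have two_p : (2 : k) ^+ p = 2.
    have := Fp_expp p_pr k 2; by rewrite -in_algE rmorph_nat.
  by rewrite /x exprMn frobD // sN Fp_expp // exprVn two_p.
have xy : x - y != 0.
  rewrite /x /y (_ : _ - _ = s); last by field.
  by apply: contraNneq sp => ->; rewrite expr0n gtn_eqF ?prime_gt0.
have x0 : x != 0.
  by apply: contraNneq xy => x0; rewrite -xp x0 expr0n gtn_eqF ?prime_gt0 // subrr.
have tors := ext_torsion.
case: rho_cusp => _ _ _ /(_ (gl2 A) x) trE.
have -> : mxchar rho A = - (nu x + nu x ^+ p).
  apply: trE.
    apply: contra xy => /vlineP[c xE]; rewrite -xp xE Fp_expp //.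
    by rewrite subrr.
  rewrite gl2K // xp char_poly2.
  rewrite rmorphD rmorphB rmorphXn /= -mul_polyC rmorphM /= map_polyX !map_polyC /=.
  by rewrite xDy xMy (polyCD x y) (polyCM x y); ring.
have -> : brauer_trace p a b (\tr A)%:A (\det A)%:A =
    - (x ^+ (a + p * b) + (x ^+ (a + p * b)) ^+ p).
  apply: (mulfI xy); rewrite xDy xMy brauer_trace_roots // -xp -!exprM -!exprD.
  have xpp n : x ^+ (n + p ^ 2) = x ^+ n.+1.
    by rewrite exprD (ext_expf p_pr dim2) exprSr.
  have -> : (a + p * (p + b) = p * b + a + p ^ 2)%N by ring.
  have -> : ((a + p * b) * p = a * p + b * p ^ 2)%N by ring.
  have -> : x ^+ (a * p + b * p ^ 2) = x ^+ (a * p + b).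
    rewrite !exprD; congr (_ * _); rewrite mulnC exprM.
    by rewrite (ext_expf p_pr dim2).
  by rewrite xpp (mulnC a p) mulnS !(exprD, exprS); ring.
rewrite nuE // -!(tauX tau_P).
apply: (reducesN P_prime tau_P tors); apply: (reducesD P_prime tau_P);
  exact: (reduces_tau P_prime tau_P tors).
Qed.

End TraceReduction.

(** * The two tori of GL_2(F_p) in a cuspidal representation *)

Lemma torus_mxM (R : comNzRingType) (xi x y x' y' : R) :
  torus_mx xi x y *m torus_mx xi x' y' =
    torus_mx xi (x * x' + y * y' * xi) (x * y' + y * x').
Proof. by rewrite /torus_mx mulmx2; congr mx2; ring. Qed.

Lemma det_torus_mx (R : comNzRingType) (xi x y : R) :
  \det (torus_mx xi x y) = x ^+ 2 - xi * y ^+ 2.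
Proof. by rewrite det_mx2; ring. Qed.

Section FiniteTorus.
Variables (C : numFieldType) (p : nat) (p_pr : prime p) (p_odd : odd p).
Variables (k : fieldExtType 'F_p) (dim2 : \dim {:k} = 2%N).
Variables (xi : 'F_p) (d : k) (d_sqr : d ^+ 2 = xi%:A) (d_notin : d \notin 1%VS).

Lemma torus_conj (x y : 'F_p) : (x%:A + y *: d) ^+ p = x%:A - y *: d.
Proof.
have dN : d ^+ p = - d.
  apply/eqP; rewrite -addr_eq0.
  have dd : d ^+ p - d != 0.
    apply: contra d_notin; rewrite subr_eq0 => /eqP /(frob_fixed p_pr)[c ->].
    by rewrite memvZ // mem1v.
  by rewrite -(inj_eq (mulfI dd)) mulr0 -subr_sqr -exprM mulnC exprM d_sqr Fp_expp // subrr.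
by rewrite frobD // Fp_expp // -[y *: d]mulr_algl exprMn dN Fp_expp // mulrN.
Qed.

Lemma torus_trace (x y : 'F_p) :
  (x%:A + y *: d) + (x%:A + y *: d) ^+ p = (x + x)%:A.
Proof. by rewrite torus_conj scalerDl addrACA subrr addr0. Qed.

Lemma torus_norm (x y : 'F_p) :
  (x%:A + y *: d) ^+ p.+1 = (x ^+ 2 - xi * y ^+ 2)%:A.
Proof.
rewrite exprS torus_conj -[y *: d]mulr_algl mulrC -subr_sqr exprMn d_sqr -!in_algE.
by rewrite rmorphB (rmorphM _ xi) !rmorphXn /= mulrC.
Qed.

Lemma torus_mx_unit (x y : 'F_p) : x%:A + y *: d != 0 -> torus_mx xi x y \in unitmx.
Proof.
move=> z0; rewrite unitmxE det_torus_mx unitfE.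
apply: contraNneq (expf_neq0 p.+1 z0) => e.
by rewrite torus_norm e scale0r.
Qed.

Variables (x0 y0 : 'F_p).
Local Notation g := (x0%:A + y0 *: d : k).
Local Notation T := (gl2 (torus_mx xi x0 y0)).

Lemma torus_power i : g != 0 -> exists x y : 'F_p,
  g ^+ i = x%:A + y *: d /\ (T ^+ i)%g = gl2 (torus_mx xi x y).
Proof.
move=> g0; elim: i => [|i [x [y [gi Ti]]]].
  exists 1, 0; rewrite scale0r scale1r addr0 expr0 expg0; split=> //.
  apply: val_inj; rewrite /= gl2K /torus_mx ?mul0r -?scalar_mx2 ?unitmx1 //.
exists (x0 * x + y0 * y * xi), (x0 * y + y0 * x); split.
  rewrite exprS gi -[y *: d]mulr_algl -[y0 *: d]mulr_algl -[_ *: d]mulr_algl -!in_algE.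
  by rewrite !(rmorphD, rmorphM) /= -d_sqr; ring.
have xy0 : x%:A + y *: d != 0 by rewrite -gi expf_neq0.
rewrite expgS Ti -(gl2M (torus_mx_unit g0) (torus_mx_unit xy0)).
by congr (gl2 _); exact: torus_mxM.
Qed.

Variables (P : C -> Prop) (P_prime : prime_ideal_above p P).
Variables (tau : k -> C) (tau_P : teichmuller P tau).
Variables (nu : k -> C) (a b : nat) (lt_ba : (b < a)%N) (lt_ap : (a < p)%N).
Hypothesis ab_odd : odd (a + b).
Hypothesis nuE : forall z, z != 0 -> nu z = tau z ^+ (a + p * b).
Variables (rho : mx_representation C 'GL_2(p) p.-1) (rho_cusp : cuspidal_rep nu rho).
Hypothesis g_prim : (p ^ 2).-1.-primitive_root g.
Variables (h : 'F_p) (hE : h%:A = g ^+ p.+1) (h_prim : p.-1.-primitive_root h).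
Local Notation D := (gl2 (mx2 h 0 0 1)).

Lemma split_power e : (D ^+ e)%g = gl2 (mx2 (h ^+ e) 0 0 1).
Proof.
have h0 : h != 0 by rewrite (prim_root_eq0 h_prim) -lt0n (prim_order_gt0 h_prim).
elim: e => [|e IHe].
  by apply: val_inj; rewrite /= gl2K -?scalar_mx2 ?unitmx1 //.
have uD (x : 'F_p) : x != 0 -> mx2 x 0 0 1 \in unitmx.
  by move=> nz; rewrite unit_mx2 mulr0 subr0 mulr1.
rewrite expgS IHe -(gl2M (uD _ h0) (uD _ (expf_neq0 e h0))); congr (gl2 _).
by rewrite mirabolicM mulr0 addr0 exprS.
Qed.

(** The trace of the projector is 1, because the character of [rho] vanishes at
    diag(x, 1) for x <> 1 and is p - 1 at x = 1. *)
Lemma split_proj_rank1 m (mu := tau h%:A ^+ m) (w : 'cV[C]_p.-1) : w != 0 -> rho D *m w = mu *: w ->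
  exists u : 'rV_p.-1, cyclic_proj rho p.-1 D mu = w *m u.
Proof.
move=> w0 Dw; have p1 : p.-1%:R != 0 :> C.
  by rewrite Num.Theory.pnatr_eq0 -lt0n (prim_order_gt0 h_prim).
have mu1 : mu ^+ p.-1 = 1.
  rewrite /mu exprAC -(tauX tau_P) -in_algE -rmorphXn (prim_expr_order h_prim).
  by rewrite rmorph1 (tau1 tau_P) expr1n.
have mu0 : mu != 0.
  apply: contra_eq_neq mu1 => ->.
  by rewrite expr0n gtn_eqF ?(prim_order_gt0 h_prim) // eq_sym oner_eq0.
have Gy : D \in 'GL_2(p)%g by rewrite inE.
apply: idempotent_trace1 => //.
- apply: (cyclic_proj_id Gy p1 mu0); apply: (cyclic_proj_eigen Gy p1 mu0).
  by rewrite split_power (prim_expr_order h_prim) mu1 -scalar_mx2 gl2_1 repr_mx1.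
- have := cyclic_projE rho p.-1 D mu 1%:M; rewrite mulmx1 => ->.
  have lt0p : (0 < p.-1)%N := prim_order_gt0 h_prim.
  rewrite (bigD1 (Ordinal lt0p)) //= big1 => [|e e0].
    rewrite mulmx1 expr0 invr1 mul1r addr0 split_power expr0 -scalar_mx2 -[\tr _]/(mxchar rho 1%:M).
    by rewrite mxchar1 mulVf.
  rewrite mulmx1 split_power -[\tr _]/(mxchar rho _) (mxchar_mirabolic_split p_pr rho_cusp) ?mulr0 //.
    rewrite expf_neq0 //.
    by rewrite (prim_root_eq0 h_prim) -lt0n (prim_order_gt0 h_prim).
  rewrite -(prim_order_dvd h_prim) gtnNdvd // lt0n.
  by move: e0; rewrite -val_eqE.
exact: (cyclic_proj_id Gy p1 mu0 Dw).
Qed.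

(** If the projection of [w] vanished, so would the trace of the product of the
    projectors of the two tori, since the second one has the form [w *m u].  Up to
    a factor this trace reduces to the sum of [torus_brauer_sum_neq0]. *)
Lemma torus_proj_neq0 (l m : nat) (lam := tau g ^+ (a + p * b + p.-1 * l))
    (w : 'cV[C]_p.-1) :
  (0 < l <= p)%N ->
  (l < a - b)%N && (m == (a + b - 1) %/ 2)%N
    || (a - b < l)%N && (m == (a + b + p) %/ 2)%N ->
  w != 0 -> rho D *m w = tau h%:A ^+ m *: w ->
  cyclic_proj rho p.+1 T lam *m w != 0.
Proof.
move=> l_bound lm w0 Dw; apply/eqP=> Ew.
have [u projE] := split_proj_rank1 w0 Dw.
have g0 : g != 0.
  by rewrite (prim_root_eq0 g_prim) -lt0n (prim_order_gt0 g_prim).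
have h0 : h != 0 by rewrite (prim_root_eq0 h_prim) -lt0n (prim_order_gt0 h_prim).
have := mxtrace0 C p.-1; rewrite -[X in \tr X](mul0mx _ u) -Ew -mulmxA -projE.
rewrite cyclic_projE => /eqP; rewrite mulf_eq0 invr_eq0 Num.Theory.pnatr_eq0 orFb.
apply/negP.
under eq_bigr => i _.
  rewrite mxtrace_mulC cyclic_projE mulrCA mulr_sumr.
  over.
rewrite /= -mulr_sumr mulf_neq0 ?invr_eq0 //.
  by rewrite Num.Theory.pnatr_eq0 -lt0n (prim_order_gt0 h_prim).
have tors := ext_torsion p_pr dim2.
have := torus_brauer_sum_neq0 (pchar_ext p_pr k) p_odd g_prim lt_ba lt_ap ab_odd l_bound lm.
apply: (reduces_neq0 P_prime tau_P tors).
apply: (reduces_sum P_prime tau_P tors) => i; apply: (reduces_sum P_prime tau_P tors) => e.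
rewrite mulrA /lam.
have -> : ((tau g ^+ (a + p * b + p.-1 * l)) ^+ i)^-1 = tau ((g ^+ i) ^+ (a + p * b + p.-1 * l))^-1.
  by rewrite (tauV tau_P) !(tauX tau_P) exprAC.
have -> : ((tau h%:A ^+ m) ^+ e)^-1 = tau (((g ^+ p.+1) ^+ e) ^+ m)^-1.
  by rewrite -hE (tauV tau_P) !(tauX tau_P) exprAC.
apply: (reducesM P_prime tau_P tors).
  by apply: (reducesM P_prime tau_P tors); apply: (reduces_tau P_prime tau_P tors).
have [x [y [gi Ti]]] := torus_power i g0.
have xy0 : x%:A + y *: d != 0 by rewrite -gi expf_neq0.
have uD : mx2 (h ^+ e) 0 0 1 \in unitmx.
  by rewrite unit_mx2 mulr0 subr0 mulr1 expf_neq0.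
have -> : \tr (rho (D ^+ e)%g *m rho (T ^+ i)%g) =
    mxchar rho (mx2 (h ^+ e) 0 0 1 *m torus_mx xi x y).
  by rewrite /mxchar (mxrepM rho uD (torus_mx_unit xy0)) /mxrep -(split_power e) -Ti.
have := trace_reduces p_pr p_odd dim2 P_prime tau_P lt_ba lt_ap nuE rho_cusp.
move/(_ (mx2 (h ^+ e) 0 0 1 *m torus_mx xi x y)).
rewrite unitmx_mul uD torus_mx_unit // => /(_ isT).
rewrite det_mulmx det_mx2 det_torus_mx mulmx2 mxtrace2.
rewrite !(mulr0, mul0r, mul1r, mulr1, addr0, add0r, subr0).
have two : 2 != 0 :> k := two_neq0 (pchar_ext p_pr k) p_odd.
have -> : (h ^+ e * x + x)%:A = (g ^+ i + (g ^+ i) ^+ p) * ((g ^+ p.+1) ^+ e + 1) / 2.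
  rewrite gi torus_trace -hE -!in_algE !(rmorphD, rmorphM, rmorphXn) /=; field.
  exact: two.
have -> // : (h ^+ e * (x ^+ 2 - xi * y ^+ 2))%:A = (g ^+ i) ^+ p.+1 * (g ^+ p.+1) ^+ e.
by rewrite gi torus_norm -hE -!in_algE rmorphM rmorphXn mulrC.
Qed.

End FiniteTorus.

(** * Coordinates in quadratic extensions *)

Lemma quadratic_basis (F : fieldType) (L : fieldExtType F) (e : L) :
  \dim {:L} = 2%N -> e \notin 1%VS -> forall z : L, exists x y, z = x%:A + y *: e.
Proof.
move=> dim2 e_notin z.
have dim_sum : \dim (1%VS + <[e]>)%VS = 2%N.
  have e0 : e != 0 by apply: contraNneq e_notin => ->; rewrite mem0v.
  rewrite dimv_disjoint_sum ?dimv1 ?dim_vline ?e0 //.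
  apply/eqP; rewrite -subv0; apply/subvP=> v; rewrite memv_cap => /andP[v1 /vlineP[c vE]].
  move: v1; rewrite vE; have [->|c0] := eqVneq c 0; first by rewrite scale0r !mem0v.
  by move/(memvZ c^-1); rewrite scalerA mulVf // scale1r (negPf e_notin).
have sumE : (1%VS + <[e]> = {:L})%VS by apply/eqP; rewrite eqEdim subvf dim_sum dim2.
have /memv_addP[u /vlineP[x ->] [v /vlineP[y ->] ->]] : z \in (1%VS + <[e]>)%VS.
  by rewrite sumE memvf.
by exists x, y.
Qed.

Lemma quadratic_coord_inj (F : fieldType) (L : fieldExtType F) (e : L) x y x' y' :
  e \notin 1%VS -> x%:A + y *: e = x'%:A + y' *: e -> x = x' /\ y = y'.
Proof.
move=> e_notin xy.
have yE : (y - y') *: e = (x' - x)%:A.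
  apply/eqP; rewrite !scalerBl subr_eq addrAC eq_sym subr_eq.
  by rewrite -xy addrC.
have [yy'|yy'] := eqVneq (y - y') 0.
  split; last by apply: subr0_eq.
  apply/esym/subr0_eq/eqP; move/esym/eqP: yE; rewrite yy' scale0r scaler_eq0 oner_eq0.
  by rewrite orbF.
case/negP: e_notin; rewrite -[e]scale1r -(mulVf yy') -scalerA yE.
by rewrite !memvZ // mem1v.
Qed.

(** * The p-adic integers *)

Section Padic.
Variables (p : nat) (p_pr : prime p).
Local Notation Zp := (padic_int p_pr).
Implicit Types x y z : Zp.

Lemma trunc_nat n m : trunc (n%:R : Zp) m = n%:R.
Proof. by elim: n => // n IHn; rewrite -!natr1 truncD IHn. Qed.

Lemma Zpow_natr_eq0 n m : (m%:R == 0 :> 'Z_(p ^ n.+1)) = (p ^ n.+1 %| m)%N.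
Proof. by rewrite -val_eqE /= val_Zp_nat ?ppow_gt1. Qed.

Lemma trunc0_modn z n : trunc z 0 = (trunc z n %% p)%N :> nat.
Proof. by rewrite (trunc_modn z (leq0n n)) expn1. Qed.

Lemma residueE z n : residue z = (trunc z n : nat)%:R.
Proof. by rewrite /residue (trunc0_modn z n) Fp_nat_mod. Qed.

Lemma residue_eq0E z n : (residue z == 0) = (p %| trunc z n)%N.
Proof. by rewrite (residueE z n) -(dvdn_pcharf (pchar_Fp p_pr)). Qed.

Lemma Fp_nat_mod1 m : (m %% p ^ 1)%:R = m%:R :> 'F_p.
Proof. by rewrite expn1 Fp_nat_mod. Qed.

Lemma residueD : {morph @residue p p_pr : x y / x + y}.
Proof. by move=> x y; rewrite /residue truncD (Zp_valD p_pr) Fp_nat_mod1 natrD. Qed.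

Lemma residueM : {morph @residue p p_pr : x y / x * y}.
Proof. by move=> x y; rewrite /residue truncM (Zp_valM p_pr) Fp_nat_mod1 natrM. Qed.

Lemma residue_nat n : residue (n%:R : Zp) = n%:R.
Proof. by rewrite /residue trunc_nat val_Zp_nat ?ppow_gt1 // Fp_nat_mod1. Qed.

Lemma residue1 : residue (1 : Zp) = 1. Proof. exact: (residue_nat 1). Qed.

Lemma residue_is_zmod_morphism : zmod_morphism (@residue p p_pr).
Proof.
move=> x y; apply/eqP; rewrite eq_sym subr_eq -residueD subrK; exact: eqxx.
Qed.
HB.instance Definition _ :=
  GRing.isZmodMorphism.Build Zp 'F_p (@residue p p_pr) residue_is_zmod_morphism.
HB.instance Definition _ :=
  GRing.isMonoidMorphism.Build Zp 'F_p (@residue p p_pr) (residue1, residueM).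

(** The quotient by p has its n-th truncation computed from the truncation of [z]
    of the next level. *)
Lemma residue_eq0 z : residue z = 0 -> exists z', z = p%:R * z'.
Proof.
move=> /eqP rz; have dvdz n : (p %| trunc z n)%N by rewrite -residue_eq0E.
pose w n : 'Z_(p ^ n.+1) := (trunc z n.+1 %/ p)%:R.
have w_compat n : (w n.+1 : nat)%:R = w n.
  apply: val_inj; rewrite /= /w !val_Zp_nat ?ppow_gt1 // modn_dvdm ?dvdn_exp2l //.
  have -> : trunc z n.+1 = (trunc z n.+2 %% p ^ n.+2)%N :> nat by apply: trunc_modn.
  set A := nat_of_ord (trunc z n.+2).
  rewrite [in LHS](divn_eq A (p ^ n.+2)) [(p ^ n.+2)%N in LHS]expnSr mulnA divnMDl ?prime_gt0 //.
  by rewrite modnMDl -expnSr.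
exists (PadicInt p_pr w_compat); apply: padic_ext => n; rewrite truncM trunc_nat /= /w.
by rewrite -natrM mulnC divnK // trunc_compat.
Qed.

Lemma residue_unit z : (z \is a GRing.unit) = (residue z != 0).
Proof.
apply/idP/idP => [uz|rz].
  by have := rmorph_unit (@residue p p_pr) uz; rewrite unitfE.
have cop n : coprime (p ^ n.+1) (trunc z n).
  by rewrite coprimeXl // prime_coprime // -residue_eq0E.
have uz n : trunc z n \is a GRing.unit.
  by rewrite -[trunc z n]natr_Zp unitZpE ?ppow_gt1 // cop.
pose w n := (trunc z n)^-1.
have w_compat n : (w n.+1 : nat)%:R = w n.
  have e := Zp_castM p_pr (w n.+1) (trunc z n.+1); rewrite (mulVr (uz _)) in e.
  by apply: (mulIr (uz n)); rewrite (mulVr (uz n)) -(trunc_compat z n); apply: esym e.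
apply/unitrP; exists (PadicInt p_pr w_compat).
suff e : PadicInt p_pr w_compat * z = 1 by split=> //; rewrite mulrC.
by apply: padic_ext => n; rewrite truncM; apply: (mulVr (uz n)).
Qed.

Lemma trunc_pX n z : trunc (p%:R ^+ n.+1 * z) n = 0.
Proof.
rewrite truncM -natrX trunc_nat (_ : _%:R = 0) ?mul0r //.
by apply/eqP; rewrite Zpow_natr_eq0.
Qed.

(** Divide by p as long as both residues vanish; a nonzero truncation bounds the
    number of divisions. *)
Lemma padic_split x y : (x != 0) || (y != 0) ->
  exists n x' y', [/\ x = p%:R ^+ n * x', y = p%:R ^+ n * y'
    & (residue x' != 0) || (residue y' != 0)].
Proof.
have trunc_p z n : trunc (p%:R * z) n.+1 != 0 -> trunc z n != 0.
  apply: contraNneq => z0; rewrite truncM trunc_nat -[trunc z n.+1]natr_Zp -natrM.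
  have dvdz : (p ^ n.+1 %| trunc z n.+1)%N by rewrite -Zpow_natr_eq0 trunc_compat z0.
  by have := dvdn_mul (dvdnn p) dvdz; rewrite -expnS Zpow_natr_eq0.
have main n : forall x y, (trunc x n != 0) || (trunc y n != 0) ->
  exists m x' y', [/\ x = p%:R ^+ m * x', y = p%:R ^+ m * y'
    & (residue x' != 0) || (residue y' != 0)].
  elim: n => [|n IHn] {}x {}y xy.
    exists 0%N, x, y; rewrite expr0 !mul1r; split=> //.
    have res z : trunc z 0 != 0 -> residue z != 0.
      by apply: contra; rewrite (residue_eq0E _ 0) -[trunc z 0]natr_Zp Zpow_natr_eq0 natr_Zp.
    by case/orP: xy => /res ->; rewrite ?orbT.
  have [rx|rx] := eqVneq (residue x) 0; last first.
    by exists 0%N, x, y; rewrite expr0 !mul1r rx.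
  have [ry|ry] := eqVneq (residue y) 0; last first.
    by exists 0%N, x, y; rewrite expr0 !mul1r ry orbT.
  have [x1 xE] := residue_eq0 rx; have [y1 yE] := residue_eq0 ry.
  have [|m [x' [y' [x1E y1E r]]]] := IHn x1 y1.
    by case/orP: xy; rewrite ?xE ?yE => /trunc_p ->; rewrite ?orbT.
  by exists m.+1, x', y'; rewrite xE yE x1E y1E !exprS !mulrA.
by case/orP=> /trunc_neq0[n /(_ n (leqnn n)) [/lt0n_neq0 t0 _]]; apply: (main n);
  apply/orP; [left | right].
Qed.

(** The iteration r -> r - s (r^2 - x), where s is a fixed inverse of the
    derivative modulo p, gains one digit at each step. *)
Lemma hensel_sqrt (p_odd : odd p) x : x \is a GRing.unit ->
  (exists c, c ^+ 2 = residue x) -> exists y, y ^+ 2 = x.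
Proof.
rewrite residue_unit => rx [c c2].
pose lift (u : 'F_p) : Zp := (u : nat)%:R.
have liftK u : residue (lift u) = u by rewrite /lift residue_nat natr_Zp.
have c0 : 2 * c != 0.
  rewrite mulf_neq0 //; last by apply: contraNneq rx => c0; rewrite -c2 c0 expr0n.
  rewrite -(dvdn_pcharf (pchar_Fp p_pr)) gtnNdvd //.
  by have := prime_gt1 p_pr; move: p_odd; case: (p) => [|[|[|]]].
pose s := lift (2 * c)^-1.
pose r := fix r n := if n is n'.+1 then r n' - s * (r n' ^+ 2 - x) else lift c.
have rS n : r n.+1 = r n - s * (r n ^+ 2 - x) by [].
have rP n : residue (r n) = c /\ exists e, r n ^+ 2 - x = p%:R ^+ n.+1 * e.
  elim: n => [|n [rc [e eE]]].
    split; first exact: liftK.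
    by rewrite expr1; apply: residue_eq0; rewrite rmorphB rmorphXn /= liftK c2 subrr.
  have res_p m u : residue (p%:R ^+ m.+1 * u : Zp) = 0.
    by rewrite rmorphM rmorphXn /= residue_nat (pcharf0 (pchar_Fp p_pr)) expr0n mul0r.
  split; first by rewrite rS eE rmorphB rmorphM /= rc res_p mulr0 subr0.
  have [f fE] : exists f, 1 - 2 * r n * s + s ^+ 2 * (p%:R ^+ n.+1 * e) = p%:R * f.
    apply: residue_eq0; rewrite rmorphD rmorphB rmorph1 !rmorphM /= rc liftK.
    rewrite (residue_nat 2) divff // subrr add0r.
    by rewrite -[residue (_ ^+ _) * _]rmorphM /= res_p mulr0.
  exists (e * f); rewrite rS.
  have -> : p%:R ^+ n.+2 * (e * f) = (p%:R ^+ n.+1 * e) * (p%:R * f).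
    by rewrite (exprSr _ n.+1); ring.
  by rewrite -fE -eE; ring.
have y_compat n : (trunc (r n.+1) n.+1 : nat)%:R = trunc (r n) n.
  have [_ [e eE]] := rP n.
  rewrite trunc_compat rS eE mulrCA -mulrN truncD -[X in _ + X]/(trunc _ n).
  by rewrite trunc_pX addr0.
exists (PadicInt p_pr y_compat); apply/eqP; rewrite -subr_eq0; apply/eqP/padic_ext => n.
have [_ [e eE]] := rP n.
transitivity (trunc (r n ^+ 2 - x) n); last by rewrite eE trunc_pX.
by rewrite !expr2 !truncD !truncM.
Qed.

End Padic.

(** * Integers and units of the unramified quadratic extension *)

Lemma fraction_div (R : idomainType) (q : {fraction R}) :
  exists n c : R, c != 0 /\ q = FracField.tofrac n / FracField.tofrac c.
Proof.
elim/quotW: q => r; exists \n_r, \d_r; have d0 := denom_ratioP r; split=> //.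
have td0 : FracField.tofrac (\d_r) != 0 by rewrite tofrac_eq0.
apply: (mulIf td0); rewrite divfK // -[LHS]/(FracField.mul _ _).
rewrite !piE; apply/eqmodP; rewrite /= FracField.equivfE /FracField.mulf.
by rewrite !numden_Ratio ?mulf_neq0 ?oner_eq0 // !mulr1 mulrC.
Qed.

Section UnramifiedIntegers.
Variables (p : nat) (p_pr : prime p) (p_odd : odd p).
Local Notation Zp := (padic_int p_pr).
Local Notation Qp := (padic p_pr).
Local Notation tf := (@FracField.tofrac Zp).
Variables (xi : Zp) (xi_unit : xi \is a GRing.unit).
Hypothesis xi_nonsquare : forall y : Zp, y ^+ 2 <> xi.
Variables (K : fieldExtType Qp) (delta : K) (K_delta : sqrt_extension (tf xi) delta).
Variables (k : fieldExtType 'F_p) (d : k) (k_d : sqrt_extension (residue xi) d).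
Local Notation OK := (OK_elt delta).
Local Notation red := (OK_red d).

Implicit Types x y s t u : Zp.

Lemma residue_lift (c : 'F_p) : exists x : Zp, residue x = c.
Proof. by exists (c : nat)%:R; rewrite residue_nat natr_Zp. Qed.

Lemma residue_nonsquare (c : 'F_p) : c ^+ 2 != residue xi.
Proof.
apply/eqP=> c2; have [|y y2] := @hensel_sqrt p p_pr p_odd xi xi_unit; first by exists c.
exact: xi_nonsquare y2.
Qed.

Lemma d_notin1 : d \notin 1%VS.
Proof.
apply/vlineP=> -[c dE]; case: k_d => _; rewrite dE -!in_algE -rmorphXn => /fmorph_inj /eqP.
exact/negP/residue_nonsquare.
Qed.

Lemma tf_inj : injective tf.
Proof. by move=> x y /eqP; rewrite tofrac_eq => /eqP. Qed.

Lemma norm_residue (x y : Zp) : (residue x != 0) || (residue y != 0) ->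
  residue (x ^+ 2 - xi * y ^+ 2) != 0.
Proof.
rewrite rmorphB (rmorphM _ xi) !rmorphXn /= subr_eq0.
have [->|ry] := eqVneq (residue y) 0.
  by rewrite orbF expr0n mulr0 => /= rx; rewrite expf_neq0.
move=> _; apply/eqP=> e; have /eqP := residue_nonsquare (residue x / residue y).
by rewrite expr_div_n e mulfK ?expf_neq0.
Qed.

Lemma delta_notin1 : delta \notin 1%VS.
Proof.
apply/vlineP=> -[c dE]; case: K_delta => _; rewrite dE -!in_algE -rmorphXn => /fmorph_inj.
have [x [y [y0 ->]]] := fraction_div c; rewrite expr_div_n.
have ty0 : tf y != 0 by rewrite tofrac_eq0.
move/(congr1 (fun v => v * tf y ^+ 2)); rewrite divfK ?expf_neq0 // -!rmorphXn -rmorphM.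
move/tf_inj => e.
have [|n [x' [y' [xE yE rxy]]]] := @padic_split p p_pr x y; first by rewrite y0 orbT.
have := norm_residue rxy; suff -> : x' ^+ 2 - xi * y' ^+ 2 = 0 by rewrite rmorph0 eqxx.
have pn0 : p%:R ^+ n != 0 :> Zp.
  by apply: contraNneq y0 => pn0; rewrite yE pn0 mul0r.
apply: (mulfI (mulf_neq0 pn0 pn0)); rewrite mulr0.
transitivity (x ^+ 2 - xi * y ^+ 2); first by rewrite xE yE; ring.
by rewrite e subrr.
Qed.

Lemma OK_red_neq0 (x y : Zp) : (red x y != 0) = (residue x != 0) || (residue y != 0).
Proof.
apply/idP/idP => [|rxy].
  apply: contraR; rewrite negb_or !negbK => /andP[/eqP rx /eqP ry].
  by rewrite /OK_red rx ry !scale0r addr0.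
apply: contraL rxy => /eqP; rewrite /OK_red => e.
have [-> ->] := @quadratic_coord_inj _ _ d (residue x) (residue y) 0 0 d_notin1
  (etrans e (esym (etrans (congr2 +%R (scale0r _) (scale0r _)) (addr0 _)))).
by rewrite eqxx.
Qed.

Lemma OK_redM x y x' y' :
  red x y * red x' y' = red (x * x' + y * y' * xi) (x * y' + y * x').
Proof.
rewrite /OK_red -[residue y *: d]mulr_algl -[residue y' *: d]mulr_algl -[_ *: d]mulr_algl.
rewrite -!in_algE !(rmorphD, rmorphM) /= -(proj2 k_d); ring.
Qed.

Lemma OK_eltM x y x' y' :
  OK x y * OK x' y' = OK (x * x' + y * y' * xi) (x * y' + y * x').
Proof.
rewrite /OK_elt -[tf y *: _]mulr_algl -[tf y' *: _]mulr_algl -[_ *: delta]mulr_algl.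
rewrite -!in_algE !(rmorphD, rmorphM) /= -(proj2 K_delta); ring.
Qed.

Lemma OK_elt_scalar u : OK u 0 = (tf u)%:A.
Proof. by rewrite /OK_elt rmorph0 scale0r addr0. Qed.

Lemma OK_red_scalar u : red u 0 = (residue u)%:A.
Proof. by rewrite /OK_red rmorph0 scale0r addr0. Qed.

Lemma OK_elt_neq0 x y : red x y != 0 -> OK x y != 0.
Proof.
rewrite OK_red_neq0 => rxy; apply/eqP=> OK0.
have := norm_residue rxy; suff -> : x ^+ 2 - xi * y ^+ 2 = 0 by rewrite rmorph0 eqxx.
have : OK x y * OK x (- y) = 0 by rewrite OK0 mul0r.
rewrite OK_eltM (_ : x * - y + y * x = 0); last by ring.
rewrite OK_elt_scalar => /eqP; rewrite scaler_eq0 oner_eq0 orbF tofrac_eq0 => /eqP <-.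
by ring.
Qed.

Lemma OK_eltX x y i : exists x' y', OK x y ^+ i = OK x' y' /\ red x y ^+ i = red x' y'.
Proof.
elim: i => [|i [x' [y' [e1 e2]]]].
  by exists 1, 0; rewrite OK_elt_scalar OK_red_scalar !rmorph1 !scale1r.
by rewrite !exprS e1 e2 OK_eltM OK_redM; eexists; eexists; split.
Qed.

(** Elements with the same nonzero reduction differ by a factor in 1 + p O_K: divide
    by x + y delta, whose inverse is its conjugate divided by its norm, a unit. *)
Lemma OK_red_eq x y x' y' : red x y != 0 -> red x y = red x' y' ->
  exists s t, OK x' y' = OK x y * (1 + p%:R * OK s t).
Proof.
move=> r0 e; have [rx ry] := quadratic_coord_inj d_notin1 e.
have [s sE] : exists s, x' - x = p%:R * s by apply: residue_eq0; rewrite rmorphB /= rx subrr.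
have [t tE] : exists t, y' - y = p%:R * t by apply: residue_eq0; rewrite rmorphB /= ry subrr.
have n0 : x ^+ 2 - xi * y ^+ 2 \is a GRing.unit.
  by rewrite residue_unit norm_residue // -OK_red_neq0.
set n := x ^+ 2 - xi * y ^+ 2 in n0.
have inv : OK x y * OK (x / n) (- y / n) = 1.
  rewrite OK_eltM (_ : x * (- y / n) + y * (x / n) = 0); last by ring.
  rewrite (_ : _ + _ = 1) ?OK_elt_scalar ?rmorph1 ?scale1r //.
  by rewrite -[RHS](divrr n0) /n; ring.
have OKD u v u' v' : OK (u + p%:R * u') (v + p%:R * v') = OK u v + p%:R * OK u' v'.
  rewrite /OK_elt -[tf (v + _) *: _]mulr_algl -[tf v *: _]mulr_algl -[tf v' *: _]mulr_algl.
  by rewrite -!in_algE !rmorphD !rmorphM !rmorph_nat; ring.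
have -> : OK x' y' = OK x y + p%:R * OK s t.
  by rewrite -OKD -sE -tE; congr (OK _ _); ring.
exists (s * (x / n) + t * (- y / n) * xi), (s * (- y / n) + t * (x / n)).
rewrite -OK_eltM.
transitivity (OK x y + p%:R * (OK s t * (OK x y * OK (x / n) (- y / n)))).
  by rewrite inv mulr1.
by ring.
Qed.

(** K^x is generated by Q_p^x and the units of O_K, as K is unramified. *)
Lemma OK_repr (z : K) : z != 0 ->
  exists q x y, [/\ q != 0, z = q%:A * OK x y & red x y != 0].
Proof.
move=> z0; have [X [Y zE]] := quadratic_basis (proj1 K_delta) delta_notin1 z.
have [n [c [c0 XE]]] := fraction_div X; have [m [e [e0 YE]]] := fraction_div Y.
have tc0 : tf c != 0 by rewrite tofrac_eq0.
have te0 : tf e != 0 by rewrite tofrac_eq0.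
have ne0 : (n * e != 0) || (m * c != 0).
  rewrite -negb_and; apply: contra z0 => /andP[]; rewrite !mulf_eq0 (negPf c0) (negPf e0) !orbF.
  by move=> /eqP n0 /eqP m0; rewrite zE XE YE n0 m0 rmorph0 !mul0r !scale0r addr0.
have [j [x [y [xE yE rxy]]]] := padic_split ne0.
exists (tf (p%:R ^+ j) / (tf c * tf e)), x, y; split.
- apply: mulf_neq0; last by rewrite invr_eq0 mulf_neq0.
  rewrite tofrac_eq0.
  by apply: contraTneq ne0 => pj0; rewrite xE yE pj0 !mul0r eqxx.
- rewrite zE /OK_elt; have -> : X = tf (p%:R ^+ j) / (tf c * tf e) * tf x.
    by rewrite mulrAC -rmorphM -xE rmorphM XE -mulf_div divff // mulr1.
  have -> : Y = tf (p%:R ^+ j) / (tf c * tf e) * tf y.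
    by rewrite mulrAC -rmorphM -yE rmorphM YE (mulrC (tf c)) -mulf_div divff // mulr1.
  by rewrite mulrDr !mulr_algl !scalerA.
by rewrite OK_red_neq0.
Qed.

Lemma OK_repr_unique q x y q' x' y' :
  q != 0 -> q%:A * OK x y = q'%:A * OK x' y' -> red x y != 0 -> red x' y' != 0 ->
  exists2 u : 'F_p, u != 0 & red x y = u%:A * red x' y'.
Proof.
move=> q0 e r0 r0'; pose r := q' / q.
have : OK x y = (r * tf x')%:A + (r * tf y') *: delta.
  have qA0 : q%:A != 0 :> K by rewrite scaler_eq0 negb_or q0 oner_eq0.
  have qr : q * r = q' by rewrite /r mulrC divfK.
  by apply: (mulfI qA0); rewrite e /OK_elt !mulrDr !mulr_algl !scalerA !(mulrA q r) qr.
case/(quadratic_coord_inj delta_notin1) => xE yE.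
have [u uE] : exists v, r = tf v.
  have div v w : tf v = r * tf w -> residue w != 0 -> exists v, r = tf v.
    move=> vE rw; have uw : w \is a GRing.unit by rewrite residue_unit.
    exists (v / w).
    by rewrite (tofracM v w^-1) vE -(mulrA r) -tofracM divrr // tofrac1 mulr1.
  by move: r0'; rewrite OK_red_neq0 => /orP[/(div _ _ xE) | /(div _ _ yE)].
have {}xE : x = u * x' by apply: tf_inj; rewrite rmorphM xE uE.
have {}yE : y = u * y' by apply: tf_inj; rewrite rmorphM yE uE.
have rE : red x y = (residue u)%:A * red x' y'.
  by rewrite /OK_red xE yE !residueM mulrDr !mulr_algl !scalerA.
exists (residue u) => //; apply: contraNneq r0 => u0.
by rewrite rE u0 scale0r mul0r.
Qed.

Section Characters.
Variable C : fieldType.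
Variables (P : C -> Prop) (P_prime : prime_ideal_above p P).
Variables (tau : k -> C) (tau_P : teichmuller P tau).

Lemma char_OK_red (chi : K -> C) x y x' y' : is_character chi -> trivial_on_1pOK delta chi ->
  red x y != 0 -> red x y = red x' y' -> chi (OK x y) = chi (OK x' y').
Proof.
move=> [chi0 chiM] chi1 r0 e; have [s [t xE]] := OK_red_eq r0 e.
have OK0 := OK_elt_neq0 r0; have OK0' : OK x' y' != 0 by apply: OK_elt_neq0; rewrite -e.
rewrite xE chiM ?chi1 ?mulr1 //.
by move: OK0'; rewrite xE mulf_eq0 negb_or => /andP[].
Qed.

(** For z = q w with q in Q_p^x and w a unit, this is the Teichmuller lift of the
    (p-1)-st power of the reduction of w.  It is a generator of the group of
    characters of K^x trivial on Q_p^x and on 1 + p O_K. *)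
Definition angular (z : K) : C :=
  if pselect (exists t : Qp * Zp * Zp,
    [/\ t.1.1 != 0, z = t.1.1%:A * OK t.1.2 t.2 & red t.1.2 t.2 != 0]) is left e
  then tau (red (projT1 (cid e)).1.2 (projT1 (cid e)).2) ^+ p.-1 else 0.

Lemma tau_Fp_expp (u : 'F_p) : u != 0 -> tau u%:A ^+ p.-1 = 1.
Proof.
move=> u0; rewrite -(tauX tau_P).
have uA0 : u%:A != 0 :> k by rewrite scaler_eq0 negb_or u0 oner_eq0.
suff -> : (u%:A : k) ^+ p.-1 = 1 by rewrite (tau1 tau_P).
by apply: (mulfI uA0); rewrite -exprS prednK ?prime_gt0 // mulr1 (Fp_expp p_pr).
Qed.

Lemma angularE q x y : q != 0 -> red x y != 0 ->
  angular (q%:A * OK x y) = tau (red x y) ^+ p.-1.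
Proof.
move=> q0 r0; rewrite /angular; case: pselect => [ex|[]]; last by exists (q, x, y).
case: cid => -[[q' x'] y'] /= [q0' e r0'].
have [u u0 ->] := OK_repr_unique q0 e r0 r0'.
by rewrite (tauM tau_P) exprMn tau_Fp_expp // mul1r.
Qed.

Lemma angular_char : is_character angular.
Proof.
split=> [z z0|z z' z0 z0'].
  have [q [x [y [q0 -> r0]]]] := OK_repr z0.
  by rewrite angularE // expf_neq0 // (tau_neq0 tau_P).
have [q [x [y [q0 -> r0]]]] := OK_repr z0.
have [q' [x' [y' [q0' -> r0']]]] := OK_repr z0'.
have -> : q%:A * OK x y * (q'%:A * OK x' y') =
    (q * q')%:A * OK (x * x' + y * y' * xi) (x * y' + y * x').
  by rewrite mulrACA OK_eltM -!in_algE rmorphM.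
rewrite !angularE ?mulf_neq0 //; last by rewrite -OK_redM mulf_neq0.
by rewrite -OK_redM (tauM tau_P) exprMn.
Qed.

Lemma char_twist (chi : K -> C) l : is_character chi ->
  is_character (fun z => chi z * angular z ^+ l).
Proof.
move=> [chi0 chiM]; have [an0 anM] := angular_char; split=> [z z0|z z' z0 z0'].
  by rewrite mulf_neq0 ?expf_neq0 ?chi0 ?an0.
by rewrite chiM // anM // exprMn mulrACA.
Qed.

End Characters.
End UnramifiedIntegers.

(** * Labels of characters and test vectors *)

(** Both sides of the congruence exceed a + p b by less than p^2 - 1, so they are
    equal. *)
Lemma lt_label_mod p a b l A : (1 < p)%N -> (b < a < p)%N -> (l <= p)%N ->
  (a + p * b < A < b + p * a)%N ->
  A = a + p * b + p.-1 * l %[mod (p ^ 2).-1] -> (l < a - b)%N.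
Proof.
move=> p_gt1 /andP[lt_ba lt_ap] le_lp /andP[gtA ltA] /eqP.
have [q pE] : exists q, p = q.+1 by exists p.-1; lia.
have [s aE] : exists s, a = (b + s)%N by exists (a - b)%N; lia.
have [t AE] : exists t, A = (a + p * b + t)%N by exists (A - (a + p * b))%N; lia.
have lt_t : (t < q * s)%N by move: ltA; rewrite AE aE pE; nia.
rewrite predn_sqr AE eqn_modDl pE /= !modn_small => [/eqP tE||].
- by rewrite aE addKn; move: lt_t; rewrite tE ltn_pmul2l //; lia.
- by rewrite ltn_pmul2l; lia.
- by apply: leq_trans lt_t _; rewrite leq_pmul2l; lia.
Qed.

Section TestVector.
Variables (C : numFieldType) (p : nat) (p_pr : prime p) (p_odd : odd p).
Local Notation Zp := (padic_int p_pr).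
Local Notation Qp := (padic p_pr).
Local Notation tf := (@FracField.tofrac Zp).
Variables (xi : Zp) (xi_unit : xi \is a GRing.unit).
Hypothesis xi_nonsquare : forall y : Zp, y ^+ 2 <> xi.
Variables (K : fieldExtType Qp) (delta : K) (K_delta : sqrt_extension (tf xi) delta).
Variables (k : fieldExtType 'F_p) (d : k) (k_d : sqrt_extension (residue xi) d).
Variables (P : C -> Prop) (P_prime : prime_ideal_above p P).
Variables (tau : k -> C) (tau_P : teichmuller P tau).
Variables (nu : k -> C) (a b : nat) (lt_ba : (b < a)%N) (lt_ap : (a < p)%N).
Hypothesis nuE : forall z, z != 0 -> nu z = tau z ^+ (a + p * b).
Variables (omega : Qp -> C) (V : lmodType C) (pi : 'M[Qp]_2 -> V -> V).
Hypothesis pi_nu : depth_zero_supercuspidal pi nu omega.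
Variables (chi : K -> C) (chi_char : is_character chi).
Hypothesis chi_trivial : trivial_on_1pOK delta chi.
Hypothesis chi_omega : forall x : Qp, x != 0 -> chi x%:A = omega x.
Local Notation OK := (OK_elt delta).
Local Notation red := (OK_red d).
Local Notation xi' := (residue xi).

Let dim2 : \dim {:k} = 2%N := proj1 k_d.
Let d_notin := d_notin1 p_odd xi_unit xi_nonsquare k_d.
Let tors := ext_torsion p_pr dim2.

Lemma tau_eq1 z : tau z = 1 -> z = 1.
Proof.
move=> tz; apply/eqP/contraT; rewrite -subr_eq0 => z1.
have r : reduces_to P tau (tau z - 1) (z - 1).
  apply: (reducesD P_prime tau_P); first exact: (reduces_tau P_prime tau_P tors).
  apply: (reducesN P_prime tau_P tors); exact: (reduces1 P_prime tau_P tors).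
by have := reduces_neq0 P_prime tau_P tors r z1; rewrite tz subrr eqxx.
Qed.

Lemma tau_prim n z : n.-primitive_root z -> n.-primitive_root (tau z).
Proof.
rewrite /primitive_root_of_unity => /andP[-> /forallP Hz] /=.
apply/forallP=> i; rewrite -(eqP (Hz i)) !unity_rootE -(tauX tau_P).
apply/eqP; apply/eqP/eqP=> [/tau_eq1 //|->]; exact: (tau1 tau_P).
Qed.

Variable g : k.
Hypothesis g_prim : (p ^ 2).-1.-primitive_root g.

Let g0 : g != 0.
Proof. by rewrite (prim_root_eq0 g_prim) -lt0n (prim_order_gt0 g_prim). Qed.

Lemma lift_red (z : k) : exists x y : Zp, red x y = z.
Proof.
have [u [v zE]] := quadratic_basis dim2 d_notin z.
have [x xE] := residue_lift p_pr u; have [y yE] := residue_lift p_pr v.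
by exists x, y; rewrite /OK_red xE yE zE.
Qed.

(** On units chi depends on the reduction only.  Its value at a lift of [g] and the
    value of nu at [g] have the same (p+1)-st power, because g^(p+1) is in F_p, so
    they differ by a (p+1)-st root of unity. *)
Lemma char_label : exists2 l, (l < p.+1)%N &
  inflates delta d (fun z => tau z ^+ (a + p * b + p.-1 * l)) chi.
Proof.
have [x0 [y0 gE]] := lift_red g.
pose c := chi (OK x0 y0).
have OK0 : OK x0 y0 != 0.
  by apply: (OK_elt_neq0 p_odd xi_unit xi_nonsquare K_delta k_d); rewrite gE.
have [chi0 chiM] := chi_char.
have chiX z n : z != 0 -> chi (z ^+ n) = chi z ^+ n.
  move=> z0; elim: n => [|n IHn]; last by rewrite !exprS chiM ?expf_neq0 ?IHn.
  have := chiM 1 1 (oner_neq0 _) (oner_neq0 _); rewrite mulr1 !expr0.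
  by move=> e; apply: (mulfI (chi0 1 (oner_neq0 _))); rewrite mulr1.
have chi_red x y i : red x y = g ^+ i -> chi (OK x y) = c ^+ i.
  move=> e; have [x' [y' [e1 e2]]] := OK_eltX K_delta k_d x0 y0 i.
  rewrite -chiX // e1.
  apply: (char_OK_red p_odd xi_unit xi_nonsquare K_delta k_d chi_char chi_trivial).
    by rewrite e expf_neq0.
  by rewrite -e2 gE.
have [h hE h_prim] := norm_gen p_pr dim2 g_prim.
have h0 : h != 0 by rewrite (prim_root_eq0 h_prim) -lt0n (prim_order_gt0 h_prim).
have [H rH] := residue_lift p_pr h.
have uH : H \is a GRing.unit by rewrite residue_unit rH.
have cp : c ^+ p.+1 = (tau g ^+ (a + p * b)) ^+ p.+1.
  rewrite -(chi_red H 0) ?OK_red_scalar ?rH // OK_elt_scalar chi_omega; last first.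
    by rewrite tofrac_eq0; apply: contraTneq uH => ->; rewrite unitr0.
  case: pi_nu => _ [_ -> // _]; rewrite rH hE nuE ?expf_neq0 // (tauX tau_P).
  by rewrite exprAC.
have tg0 : tau g != 0 := tau_neq0 tau_P g0.
have [|[l lt_l] /= cE] := prim_rootP (tau_prim (prim_ratio g_prim)) (x := c / tau g ^+ (a + p * b)).
  by rewrite expr_div_n cp divff // !expf_neq0.
exists l => // x y rxy; have [i ri] := gen_power p_pr dim2 g_prim rxy.
rewrite (chi_red _ _ _ ri) ri (tauX tau_P).
have -> : c = tau g ^+ (a + p * b + p.-1 * l).
  by rewrite exprD exprM -[tau g ^+ p.-1](tauX tau_P) -cE mulrC divfK // expf_neq0.
by rewrite exprAC.
Qed.

(** The labels of the character of exponent a + p b + (p-1) l are a - l and b + l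
    if 0 < l < a - b. *)
Lemma type1_label l : inflates delta d (fun z => tau z ^+ (a + p * b + p.-1 * l)) chi ->
  (0 < l <= p)%N -> type1 delta d tau a b chi <-> (l < a - b)%N.
Proof.
move=> chi_l /andP[l_gt0 le_lp]; split=> [[r [s [_ chi_rs lt_ab]]]|lt_l].
  have [x [y rg]] := lift_red g; have r0 : red x y != 0 by rewrite rg.
  apply: (lt_label_mod (prime_gt1 p_pr) _ le_lp lt_ab); first by rewrite lt_ba.
  apply/eqP; rewrite -(eq_prim_root_expr (tau_prim g_prim)) -rg -chi_l //.
  by rewrite chi_rs.
have expE : (a - l + p * (b + l) = a + p * b + p.-1 * l)%N.
  have [t ->] : exists t, a = (t + l)%N by exists (a - l)%N; lia.
  rewrite addnK -[p in LHS](prednK (prime_gt0 p_pr)).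
  by rewrite -[p in RHS](prednK (prime_gt0 p_pr)) /=; ring.
exists (a - l)%N, (b + l)%N; split.
- by split; rewrite ?xpair_eqE; lia.
- by move=> x y r0; rewrite chi_l // /label_char expE.
rewrite expE -[X in (X < _)%N]addn0 ltn_add2l muln_gt0 l_gt0 -ltnS.
rewrite prednK ?prime_gt0 // prime_gt1 //=.
have [t tE] : exists t, a = (b + t)%N by exists (a - b)%N; lia.
have -> : (b + p * a = a + p * b + p.-1 * (a - b))%N.
  rewrite tE addKn -[p in LHS](prednK (prime_gt0 p_pr)).
  by rewrite -[p in X in _ = (_ + X + _)%N](prednK (prime_gt0 p_pr)) /=; ring.
by rewrite ltn_add2l ltn_pmul2l // -ltnS prednK ?prime_gt0 // prime_gt1.
Qed.

(** The characters of K^x that occur in the type are the twists of chi by the powers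
    of [angular], and the corresponding projectors sum to 1. *)
Lemma test_vector_of_label l m v : odd (a + b) ->
  inflates delta d (fun z => tau z ^+ (a + p * b + p.-1 * l)) chi ->
  (0 < l <= p)%N ->
  (l < a - b)%N && (m == (a + b - 1) %/ 2)%N
    || (a - b < l)%N && (m == (a + b + p) %/ 2)%N ->
  torus_eigenvector pi (fun x => tau x%:A ^+ m) v ->
  test_vector pi xi delta chi v.
Proof.
move=> ab_odd chi_l l_bound lm [v_fix v0 v_eig].
case: pi_nu => [[[_ _ piM] _ _ _ _]].
case=> [cent omega_nu [rho [rho_cusp [f [f_lin f_inj f_fix f_act]]]]].
have f0 : f 0 = 0.
  by have := f_lin (-1) 0 0; rewrite scaler0 addr0 scaleN1r addNr.

have fZ c w : f (c *: w) = c *: f w by have := f_lin c w 0; rewrite !addr0 f0 addr0.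
have fD w w' : f (w + w') = f w + f w' by have := f_lin 1 w w'; rewrite !scale1r.
have f_sum n (F : 'I_n -> 'cV_p.-1) : f (\sum_i F i) = \sum_i f (F i).
  by apply: (big_morph f fD f0).
have [w0 vE] : exists w, f w = v by apply/f_fix.
have w0_neq0 : w0 != 0 by apply: contraNneq v0 => w00; rewrite -vE w00 f0.
have [x0 [y0 gE]] := quadratic_basis dim2 d_notin g.
have [h hE h_prim] := norm_gen p_pr dim2 g_prim.
have h0 : h != 0 by rewrite (prim_root_eq0 h_prim) -lt0n (prim_order_gt0 h_prim).
have [H rH] := residue_lift p_pr h.
pose D := gl2 (mx2 h 0 0 1); pose T := gl2 (torus_mx xi' x0 y0).
have Dw : rho D *m w0 = tau h%:A ^+ m *: w0.
  apply: f_inj; rewrite fZ vE -rH -v_eig ?residue_unit ?rH //.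
  have uD : mx2 h 0 0 1 \in unitmx by rewrite unit_mx2 mulr0 subr0 mulr1.
  rewrite -(f_act (mx2 H 0 0 1)) ?vE; last by rewrite gl2K // map_mx2 rH !rmorph0 rmorph1.
  by rewrite map_mx2 !rmorph0 rmorph1.
pose lam j := tau g ^+ (a + p * b + p.-1 * j).
pose E j := cyclic_proj rho p.+1 T (lam j).
have lam0 j : lam j != 0 by rewrite expf_neq0 // (tau_neq0 tau_P).
have TG : T \in ('GL_2(p))%g by rewrite inE.
have p1 : p.+1%:R != 0 :> C by rewrite Num.Theory.pnatr_eq0.
have tpow := @torus_power p p_pr k xi' d (proj2 k_d) d_notin x0 y0.
have Tp j : rho (T ^+ p.+1)%g = (lam j ^+ p.+1)%:M.
  have [|x [y [gp Tp]]] := tpow p.+1; first by rewrite -gE.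
  have [xh yh] : x = h /\ y = 0.
    by apply: (quadratic_coord_inj d_notin); rewrite -gp -gE -hE scale0r addr0.
  rewrite /T Tp xh yh /torus_mx mul0r -scalar_mx2.
  case: rho_cusp => _ _ centr _; rewrite (centr _ h) ?gl2K //; last first.
    by rewrite unitmxE det_scalar unitfE expf_neq0.
  congr (_%:M); rewrite hE nuE ?expf_neq0 // (tauX tau_P) /lam [in RHS]exprD exprMn exprAC.
  rewrite -[in RHS](exprM _ (p.-1 * j)) mulnAC exprM -predn_sqr.
  by rewrite (prim_expr_order (tau_prim g_prim)) expr1n mulr1.
have delta_notin := delta_notin1 p_odd xi_unit xi_nonsquare K_delta.
(* An element of K^x is q w with q scalar and w a unit, reducing to a power of T. *)
have E_torus j : torus_eigenspace pi xi delta
    (fun z => chi z * angular delta d tau z ^+ j) (f (E (l + j)%N *m w0)).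
  move=> X Y XY0.
  have [q [x [y [q0 zE r0]]]] := OK_repr p_odd xi_unit xi_nonsquare K_delta k_d XY0.
  have [XE YE] : X = q * tf x /\ Y = q * tf y.
    by apply: (quadratic_coord_inj delta_notin); rewrite zE /OK_elt mulrDr !mulr_algl !scalerA.
  have -> : torus_mx (tf xi) X Y = q%:M *m map_mx tf (torus_mx xi x y).
    rewrite /torus_mx map_mx2 scalar_mx2 mulmx2 !mul0r !addr0 !add0r -XE -YE.
    by rewrite tofracM mulrA -YE.
  have q_unit : (q%:M : 'M_2) \in unitmx by rewrite unitmxE det_scalar unitfE expf_neq0.
  have A_unit : map_mx tf (torus_mx xi x y) \in unitmx.
    rewrite unitmxE det_map_mx det_torus_mx unitfE tofrac_eq0.
    have := r0; rewrite (OK_red_neq0 p_odd xi_unit xi_nonsquare k_d).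
    move/(norm_residue p_odd xi_unit xi_nonsquare); apply: contraNneq => ->.
    by rewrite rmorph0.
  rewrite (piM _ _ _ q_unit A_unit) (cent _ _ q0).
  rewrite (f_act _ (gl2 (torus_mx xi' (residue x) (residue y)))); last first.
    rewrite gl2K ?(torus_mx_unit p_pr (proj2 k_d) d_notin) //.
    by rewrite /torus_mx map_mx2 rmorphM.
  have [i ri] := gen_power p_pr dim2 g_prim r0.
  have [|x' [y' [gi Ti]]] := tpow i; first by rewrite -gE.
  have [-> ->] : residue x = x' /\ residue y = y'.
    by apply: (quadratic_coord_inj d_notin); rewrite -gi -gE -ri.
  rewrite -Ti mulmxA (cyclic_proj_eigenX TG p1 _ (lam0 _) (Tp _)) -scalemxAl fZ scalerA.
  congr (_ *: _); rewrite zE (proj2 chi_char); last 2 first.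
  - by rewrite scaler_eq0 negb_or q0 oner_eq0.
  - exact: (OK_elt_neq0 p_odd xi_unit xi_nonsquare K_delta k_d).
  rewrite chi_omega // chi_l // (angularE p_odd xi_unit xi_nonsquare K_delta k_d tau_P) //.
  rewrite -mulrA ri !(tauX tau_P) /lam; congr (_ * _).
  rewrite -!exprM -exprD; congr (_ ^+ _); ring.
have E0 : f (E l *m w0) != 0.
  rewrite -f0 (inj_eq f_inj) /E /lam {1}gE.
  apply: (torus_proj_neq0 p_pr p_odd dim2 (proj2 k_d) d_notin P_prime tau_P lt_ba lt_ap
    ab_odd nuE rho_cusp _ _ h_prim l_bound lm w0_neq0 Dw); by rewrite -gE.
exists (f (E l *m w0)) => //; split.
  by move=> X Y XY0; have := E_torus 0%N X Y XY0; rewrite expr0 mulr1 addn0.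
exists p, (fun (i : 'I_p) z => chi z * angular delta d tau z ^+ i.+1),
  (fun i => f (E (l + i.+1)%N *m w0)); split=> [i|].
  split=> //; first exact: (char_twist p_odd xi_unit xi_nonsquare K_delta k_d tau_P).
  have [x [y rg]] := lift_red g; have r0 : red x y != 0 by rewrite rg.
  have O0 := OK_elt_neq0 p_odd xi_unit xi_nonsquare K_delta k_d r0.
  exists (OK x y) => //; rewrite -[X in angular _ _ _ X]mul1r -[X in X * OK x y](scale1r 1).
  rewrite (angularE p_odd xi_unit xi_nonsquare K_delta k_d tau_P) ?oner_eq0 // rg.
  rewrite -{2}[chi _]mulr1 (inj_eq (mulfI (proj1 chi_char _ O0))) -(tauX tau_P).
  by rewrite -(prim_order_dvd (tau_prim (prim_ratio g_prim))) gtnNdvd // ltnS ltn_ord.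
have zeta_prim := tau_prim (prim_ratio g_prim).
rewrite -vE -{1}[w0]mul1mx -(sum_cyclic_proj rho T p1 (lam0 l) zeta_prim).
have lamM i : lam l * tau (g ^+ p.-1) ^+ i = lam (l + i)%N.
  by rewrite (tauX tau_P) /lam -exprM -exprD -addnA -mulnDr.
under eq_bigr do rewrite lamM.
by rewrite big_ord_recl addn0 mulmxDl mulmx_suml fD f_sum.
Qed.

End TestVector.

Theorem theorem1p4 (R : realType) (p : nat) (p_pr : prime p) (p_odd : odd p)
  (xi : padic_int p_pr) (xi_unit : xi \is a GRing.unit)
  (xi_nonsquare : forall y : padic_int p_pr, y ^+ 2 <> xi)
  (K : fieldExtType (padic p_pr)) (delta : K)
  (K_delta : sqrt_extension (FracField.tofrac xi) delta)
  (k : fieldExtType 'F_p) (d : k) (k_d : sqrt_extension (residue xi) d)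
  (P : R[i] -> Prop) (P_prime : prime_ideal_above p P)
  (tau : k -> R[i]) (tau_P : teichmuller P tau)
  (nu : k -> R[i]) (nu_char : is_character nu)
  (nu_regular : exists2 z, z != 0 & nu z != nu z ^+ p)
  (a b : nat) (ab_label : is_label p a b)
  (nu_label : forall z, z != 0 -> nu z = label_char tau a b z)
  (ab_odd : odd (a + b)) (b_lt_a : (b < a)%N)
  (omega : padic p_pr -> R[i]) (omega_char : is_character omega)
  (V : lmodType R[i]) (pi : 'M[padic p_pr]_2 -> V -> V)
  (pi_nu : depth_zero_supercuspidal pi nu omega)
  (chi : K -> R[i]) (chi_char : is_character chi)
  (chi_trivial : trivial_on_1pOK delta chi)
  (chi_omega : forall x : padic p_pr, x != 0 -> chi x%:A = omega x)
  (chi_neq_nu : ~ inflates delta d nu chi)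
  (chi_neq_nup : ~ inflates delta d (fun z => nu z ^+ p) chi) :
  let mu1 := fun x : 'F_p => tau x%:A ^+ ((a + b - 1) %/ 2)%N in
  let mu2 := fun x : 'F_p => tau x%:A ^+ ((a + b + p) %/ 2)%N in
  ((1 < a - b)%N ->
     (type1 delta d tau a b chi -> forall v, torus_eigenvector pi mu1 v ->
        test_vector pi xi delta chi v) /\
     (type2 delta d tau a b chi -> forall v, torus_eigenvector pi mu2 v ->
        test_vector pi xi delta chi v)) /\
  ((a - b = 1)%N ->
     forall v, torus_eigenvector pi mu2 v -> test_vector pi xi delta chi v).
Proof.
move=> mu1 mu2.
have lt_ap : (a < p)%N by case: ab_label.
have nuE z : z != 0 -> nu z = tau z ^+ (a + p * b) by apply: nu_label.
have [g g_prim] := ext_generator p_pr (proj1 k_d).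
have [l lt_l chi_l] := char_label p_odd xi_unit xi_nonsquare K_delta k_d P_prime tau_P
  nuE pi_nu chi_char chi_trivial chi_omega g_prim.
have l_gt0 : (0 < l)%N.
  rewrite lt0n; apply: contra_notN chi_neq_nu => /eqP l0 x y rxy.
  by rewrite chi_l // l0 muln0 addn0 nuE.
have l_neq : l != (a - b)%N.
  apply: contra_notN chi_neq_nup => /eqP lE x y rxy.
  rewrite chi_l // nuE // -!(tauX tau_P) -exprM.
  (* As z^(p^2) = z, the exponent of nu^p is b + p a, that of l = a - b. *)
  have -> : (a + p * b + p.-1 * l = a * p + b)%N by nia.
  have -> : ((a + p * b) * p = a * p + b * p ^ 2)%N by ring.
  by rewrite !exprD (mulnC b) (exprM _ (p ^ 2)) (ext_expf p_pr (proj1 k_d)).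
have l_bound : (0 < l <= p)%N by rewrite l_gt0.
have test := test_vector_of_label p_odd xi_unit xi_nonsquare K_delta k_d P_prime tau_P
  b_lt_a lt_ap nuE pi_nu chi_char chi_omega g_prim ab_odd chi_l l_bound.
have type1P := type1_label p_odd xi_unit xi_nonsquare k_d P_prime tau_P b_lt_a lt_ap
  g_prim chi_l l_bound.
split=> [ab_gt1 | ab_eq1 v]; last by apply: test; rewrite eqxx; lia.
split=> chi_type v.
  by apply: test; move/type1P: chi_type => ->; rewrite eqxx.
apply: test; rewrite eqxx andbT; apply/orP; right.
by rewrite ltn_neqAle eq_sym l_neq leqNgt; apply/negP => /type1P.
Qed.
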